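(* For each projective space $\mathbb{FP}^{d-1}$ there exist positive constants $C_0,C_0'$ such that for all $N\ge 2$ $$-C_0 N\log(N)\le \mathcal{E}_{K_0}(\mathbb{FP}^{d-1},N)-I_{K_0}(\sigma)N^2\le -C_0' N\log(N).$$
   Context: Projective spaces: $\mathbb{F}\in\{\mathbb{R},\mathbb{C},\mathbb{H},\mathbb{O}\}$, $d\ge 3$ an integer, with $d=3$ when $\mathbb{F}=\mathbb{O}$. $\mathbb{FP}^{d-1}$ may be realized as the set of Hermitian $d\times d$ matrices $\Pi$ over $\mathbb{F}$ with $\Pi^2=\Pi$ and $\mathrm{Tr}(\Pi)=1$. It carries its isometry-invariant Riemannian metric, normalized so that the geodesic distance $\vartheta$ takes values in $[0,\frac{\pi}{2}]$ (diameter $\frac\pi2$). The chordal metric is $\rho(x,y)=\sin(\vartheta(x,y))$; in the matrix model $\rho(\Pi_1,\Pi_2)=\sqrt{1-\langle\Pi_1,\Pi_2\rangle}$ with $\langle A,B\rangle=\mathrm{Re}\sum_{i,j}a_{ij}\overline{b_{ij}}$. $\sigma$ is the isometry-invariant Borel probability measure (normalized Riemannian volume). $K_0(x,y)=-\log\rho(x,y)$. $I_K(\mu)=\iint K\,d\mu\,d\mu$; $E_K(\omega_N)=\sum_{i\ne j}K(x_i,x_j)$ for $\omega_N=\{x_1,\dots,x_N\}$; $\mathcal{E}_K(\Omega,N)=\min_{\omega_N\subset\Omega}E_K(\omega_N)$, the minimum over $N$-point configurations. *)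

(* Defs.v *)
From HB Require Import structures.
From mathcomp Require Import all_boot all_order all_algebra.
From mathcomp Require Import all_classical all_reals all_analysis.

Set Implicit Arguments.
Unset Strict Implicit.
Unset Printing Implicit Defensive.

Import Order.TTheory GRing.Theory Num.Theory.
Import numFieldNormedType.Exports.

Local Open Scope classical_set_scope.
Local Open Scope ring_scope.

(* The Cayley-Dickson tower over R: levels 0, 1, 2, 3 are the reals, complex
   numbers, quaternions and octonions.  The norm carried by the product
   structure is the sup norm and is used only for its topology. *)
Fixpoint cd (R : realType) (n : nat) : normedModType R :=
  if n is m.+1 then (cd R m * cd R m)%type else R^o.

Section CayleyDickson.
Variable R : realType.

Fixpoint cd_one n : cd R n :=
  match n return cd R n with
  | 0 => (1 : R)
  | m.+1 => (cd_one m, 0)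
  end.

Fixpoint cd_re n : cd R n -> R :=
  match n return cd R n -> R with
  | 0 => fun x => x
  | m.+1 => fun x => cd_re x.1
  end.

Fixpoint cd_conj n : cd R n -> cd R n :=
  match n return cd R n -> cd R n with
  | 0 => fun x => x
  | m.+1 => fun x => (cd_conj x.1, - x.2)
  end.

(* (a, b)(c, d) = (ac - d^* b, da + bc^* ) *)
Fixpoint cd_mul n : cd R n -> cd R n -> cd R n :=
  match n return cd R n -> cd R n -> cd R n with
  | 0 => fun x y : R => x * y
  | m.+1 => fun x y =>
      (cd_mul x.1 y.1 - cd_mul (cd_conj y.2) x.2,
       cd_mul y.2 x.1 + cd_mul x.2 (cd_conj y.1))
  end.

End CayleyDickson.

Inductive scalars := Reals | Complexes | Quaternions | Octonions.

Definition cd_level (F : scalars) : nat :=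
  match F with
  | Reals => 0
  | Complexes => 1
  | Quaternions => 2
  | Octonions => 3
  end.

Notation scalar R F := (cd R (cd_level F)).

Section ProjectiveSpace.
Variables (R : realType) (F : scalars) (n : nat).

(* MathComp's *m requires an associative multiplication of the entries. *)
Definition hmulmx (A B : 'M[scalar R F]_n.+1) : 'M[scalar R F]_n.+1 :=
  \matrix_(i, j) \sum_k cd_mul (A i k) (B k j).

Definition hermitian (A : 'M[scalar R F]_n.+1) : Prop :=
  forall i j, A j i = cd_conj (A i j).

(* FP^n; the coercion of sets to types gives it the subspace topology. *)
Definition projspace : set 'M[scalar R F]_n.+1 :=
  [set P | [/\ hermitian P, hmulmx P P = P & \tr P = cd_one R (cd_level F)]].

Definition hdot (A B : 'M[scalar R F]_n.+1) : R :=
  cd_re (\sum_i \sum_j cd_mul (A i j) (cd_conj (B i j))).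

Definition chordal (x y : projspace) : R :=
  Num.sqrt (1 - hdot (set_val x) (set_val y)).

(* The geodesic distance theta in [0, pi/2], normalized by rho = sin theta. *)
Definition geodist (x y : projspace) : R := asin (chordal x y).

Definition isometry (g : projspace -> projspace) : Prop :=
  bijective g /\ forall x y, geodist (g x) (g y) = geodist x y.

(* Extended-real logarithm, so that K0 x x = +oo. *)
Definition K0 (x y : projspace) : \bar R := (- lne (chordal x y)%:E)%E.

End ProjectiveSpace.

Arguments projspace R F n : clear implicits.
Arguments K0 R F n : clear implicits.

Section ProjspacePointed.
Variables (R : realType) (F : scalars) (n : nat).

Lemma cd_conj0 k : cd_conj (0 : cd R k) = 0.
Proof. by elim: k => //= k ->; rewrite oppr0. Qed.

Lemma cd_conj1 k : cd_conj (cd_one R k) = cd_one R k.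
Proof. by elim: k => //= k ->; rewrite oppr0. Qed.

Lemma cd_mul0 k : (forall x : cd R k, cd_mul 0 x = 0) /\
  (forall x : cd R k, cd_mul x 0 = 0).
Proof.
elim: k => [|k [IHl IHr]] /=; first by split=> x; rewrite ?mul0r ?mulr0.
by split=> -[x y] /=; rewrite ?cd_conj0 !(IHl, IHr) subr0 addr0.
Qed.

Lemma cd_mul1 k : cd_mul (cd_one R k) (cd_one R k) = cd_one R k.
Proof.
elim: k => [|k IH] /=; first by rewrite mulr1.
by rewrite IH cd_conj0 (cd_mul0 k).1 (cd_mul0 k).1 (cd_mul0 k).1 subr0 addr0.
Qed.

Definition projspace_pt : 'M[scalar R F]_n.+1 :=
  \matrix_(i, j) if (i == 0) && (j == 0) then cd_one R (cd_level F) else 0.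

Lemma projspace_ptP : projspace_pt \in projspace R F n.
Proof.
apply/mem_set; split.
- move=> i j; rewrite !mxE andbC.
  by case: ifP => _; rewrite ?cd_conj1 ?cd_conj0.
- apply/matrixP => i j; rewrite !mxE (bigD1 0)//= big1 ?addr0; last first.
    by move=> k /negbTE k0; rewrite !mxE k0 andbF (cd_mul0 _).1.
  rewrite !mxE eqxx andbT /=.
  by do 2 case: eqP => _ /=; rewrite ?cd_mul1 ?(cd_mul0 _).1 ?(cd_mul0 _).2.
- rewrite /mxtrace (bigD1 0)//= big1 ?addr0 ?mxE ?eqxx//.
  by move=> k /negbTE k0; rewrite mxE k0.
Qed.

HB.instance Definition _ := isPointed.Build (set_type (projspace R F n))
  (exist _ projspace_pt projspace_ptP).

End ProjspacePointed.

Notation borel_projspace R F n :=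
  (g_sigma_algebraType (@open (set_type (projspace R F n)))).

(* The isometry group acts transitively on the compact space FP^n, so exactly
   one Borel probability measure is isometry-invariant: the normalized
   Riemannian volume. *)
Definition isometry_invariant (R : realType) (F : scalars) (n : nat)
    (mu : probability (borel_projspace R F n) R) : Prop :=
  forall g : projspace R F n -> projspace R F n, isometry g ->
  forall A : set (borel_projspace R F n), measurable A ->
    mu (g @^-1` A) = mu A.

Section Energy.
Local Open Scope ereal_scope.

Definition energy_integral (R : realType) (d : measure_display)
    (T : measurableType d) (mu : probability T R) (K : T -> T -> \bar R) :
    \bar R :=
  \int[mu]_x \int[mu]_y K x y.

Definition energy (R : realType) (T : Type) (K : T -> T -> \bar R) (N : nat)
    (w : 'I_N -> T) : \bar R :=
  \sum_(i < N) \sum_(j < N | j != i) K (w i) (w j).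

(* The infimum is a minimum for lower semicontinuous K on a compact T. *)
Definition minimal_energy (R : realType) (T : Type) (K : T -> T -> \bar R)
    (N : nat) : \bar R :=
  ereal_inf (range (@energy R T K N)).

End Energy.

(* Main.v *)
From HB Require Import structures.
Require Import Defs.
From mathcomp Require Import all_boot all_order all_algebra.
From mathcomp Require Import all_classical all_reals all_analysis.
From mathcomp Require Import measurable_realfun.
From mathcomp Require Import ring lra.

Import Order.TTheory GRing.Theory Num.Theory.
Import numFieldNormedType.Exports.
Local Open Scope classical_set_scope.
Local Open Scope ring_scope.

Set Implicit Arguments.
Unset Strict Implicit.
Unset Printing Implicit Defensive.

(** The real number t(x, y) = <x, y> lies in [0, 1] on the projective space and
    the logarithmic kernel is
      - log rho = - log (1 - t) / 2 = (t + t^2/2 + t^3/3 + ...) / 2.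

    Everything rests on one geometric fact: the isometries act transitively
    ([projspace_transitive]).  Hence for an invariant measure sigma the integral
    of t(x, y)^k in y does not depend on x; call it c k.  In the same way the
    potential of the kernel is a constant V, which is the energy of sigma.
    Transitivity comes from explicit isometries: conjugations by real
    orthogonal matrices, and phase rotations of the off-diagonal entries.  Over
    an associative algebra a phase rotation is a diagonal conjugation; for the
    octonionic plane it is triality, that is, the three Moufang identities.  The
    same conditions (Hermitian, trace one, P_kj P_ji = P_jj P_ki) describe the
    points for all four algebras ([projspaceP]).

    Lower bound.  Each t^k is positive definite, so the sum of t(x_i, x_j)^k over
    all i, j is at least N^2 c k ([moment_le]).  Truncate the series after M = N^3
    terms: the off-diagonal energy loses only the diagonal terms, N times half a
    harmonic sum, of order N log N ([energy_ge]).  The discarded part of V is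
    O(1/N): applied to n well separated points, positive definiteness gives
    c (n^3) <= 5/n ([moment_cube]), hence the tail bound [moment_sum_tail].

    Upper bound.  Write N sigma as a sum of N probability measures and choose
    one point from each independently.  The mean energy is N^2 V minus the sum
    of the self-energies of these measures ([minimal_energy_le]).  A grid of
    side 2/q in the matrix coordinates, with (q + 1)^p at most N/4 cells,
    provides measures of which at least N/4 live in a single cell; there the
    kernel is at least log q - O(1), which is of order log N
    ([minimal_energy_grid]).  For the finitely many small N it suffices that
    every self-energy can be taken equal to V > 0 ([minimal_energy_uniform]). *)

(** * The Cayley-Dickson algebras *)

Section CDAlgebra.
Variable R : realType.
Implicit Types (n : nat) (r s : R).

Lemma cd_pairD n (a b c d : cd R n) :
  ((a, b) : cd R n.+1) + ((c, d) : cd R n.+1) = (a + c, b + d).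
Proof. by []. Qed.

Lemma cd_pairZ n r (a b : cd R n) : r *: ((a, b) : cd R n.+1) = (r *: a, r *: b).
Proof. by []. Qed.

Lemma cd_conjD n (x y : cd R n) : cd_conj (x + y) = cd_conj x + cd_conj y.
Proof.
elim: n x y => [//|n IH] [a b] [c d].
by rewrite cd_pairD /= IH opprD.
Qed.

Lemma cd_conjZ n r (x : cd R n) : cd_conj (r *: x) = r *: cd_conj x.
Proof. by elim: n x => [//|n IH] [a b]; rewrite cd_pairZ /= IH -scalerN. Qed.

Lemma cd_conjN n (x : cd R n) : cd_conj (- x) = - cd_conj x.
Proof. by rewrite -scaleN1r cd_conjZ scaleN1r. Qed.

Lemma cd_conjK n (x : cd R n) : cd_conj (cd_conj x) = x.
Proof. by elim: n x => [//|n IH] [a b] /=; rewrite IH opprK. Qed.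

Lemma cd_reD n (x y : cd R n) : cd_re (x + y) = cd_re x + cd_re y.
Proof. by elim: n x y => [//|n IH] [a b] [c d]; rewrite cd_pairD /= IH. Qed.

Lemma cd_reZ n r (x : cd R n) : cd_re (r *: x) = r * cd_re x.
Proof. by elim: n x => [//|n IH] [a b]; rewrite cd_pairZ /= IH. Qed.

Lemma cd_reN n (x : cd R n) : cd_re (- x) = - cd_re x.
Proof. by rewrite -scaleN1r cd_reZ mulN1r. Qed.

Lemma cd_re0 n : cd_re (0 : cd R n) = 0.
Proof. by rewrite -(scale0r 0) cd_reZ mul0r. Qed.

Lemma cd_re_sum n (I : Type) (s : seq I) (P : pred I) (f : I -> cd R n) :
  cd_re (\sum_(i <- s | P i) f i) = \sum_(i <- s | P i) cd_re (f i).
Proof. exact: (big_morph _ (@cd_reD n) (cd_re0 n)). Qed.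

Lemma cd_conj_sum n (I : Type) (s : seq I) (P : pred I) (f : I -> cd R n) :
  cd_conj (\sum_(i <- s | P i) f i) = \sum_(i <- s | P i) cd_conj (f i).
Proof. exact: (big_morph _ (@cd_conjD n) (cd_conj0 R n)). Qed.

Lemma cd_re1 n : cd_re (cd_one R n) = 1.
Proof. by elim: n => //= n ->. Qed.

Lemma cd_re_conj n (x : cd R n) : cd_re (cd_conj x) = cd_re x.
Proof. by elim: n x => [//|n IH] [a b] /=. Qed.

Lemma cd_mulD n : (forall x y z : cd R n, cd_mul (x + y) z = cd_mul x z + cd_mul y z)
  /\ (forall x y z : cd R n, cd_mul x (y + z) = cd_mul x y + cd_mul x z).
Proof.
elim: n => [|n [IHl IHr]]; first by split=> x y z /=; [exact: mulrDl|exact: mulrDr].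
split=> -[a b] [c d] [e f]; rewrite cd_pairD /= ?cd_conjD !(IHl, IHr) cd_pairD.
  by congr pair; rewrite ?opprD addrACA.
by congr pair; rewrite ?opprD addrACA.
Qed.

Lemma cd_mulDl n (x y z : cd R n) : cd_mul (x + y) z = cd_mul x z + cd_mul y z.
Proof. exact: (cd_mulD n).1. Qed.

Lemma cd_mulDr n (x y z : cd R n) : cd_mul x (y + z) = cd_mul x y + cd_mul x z.
Proof. exact: (cd_mulD n).2. Qed.

Lemma cd_mulZ n r : (forall x y : cd R n, cd_mul (r *: x) y = r *: cd_mul x y)
  /\ (forall x y : cd R n, cd_mul x (r *: y) = r *: cd_mul x y).
Proof.
elim: n => [|n [IHl IHr]].
  by split=> x y; [exact/esym/mulrA|exact: mulrCA].
by split=> -[a b] [c d]; rewrite cd_pairZ /= ?cd_conjZ !(IHl, IHr) cd_pairZ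
  -scalerBr -scalerDr.
Qed.

Lemma cd_mulZl n r (x y : cd R n) : cd_mul (r *: x) y = r *: cd_mul x y.
Proof. exact: (cd_mulZ n r).1. Qed.

Lemma cd_mulZr n r (x y : cd R n) : cd_mul x (r *: y) = r *: cd_mul x y.
Proof. exact: (cd_mulZ n r).2. Qed.

Lemma cd_mulNl n (x y : cd R n) : cd_mul (- x) y = - cd_mul x y.
Proof. by rewrite -scaleN1r cd_mulZl scaleN1r. Qed.

Lemma cd_mulNr n (x y : cd R n) : cd_mul x (- y) = - cd_mul x y.
Proof. by rewrite -scaleN1r cd_mulZr scaleN1r. Qed.

Lemma cd_mul_suml n (I : Type) (s : seq I) (P : pred I) (f : I -> cd R n) y :
  cd_mul (\sum_(i <- s | P i) f i) y = \sum_(i <- s | P i) cd_mul (f i) y.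
Proof.
exact: (big_morph (fun x => cd_mul x y) (fun a b => cd_mulDl a b y)
         ((cd_mul0 R n).1 y)).
Qed.

Lemma cd_mul_sumr n (I : Type) (s : seq I) (P : pred I) (f : I -> cd R n) y :
  cd_mul y (\sum_(i <- s | P i) f i) = \sum_(i <- s | P i) cd_mul y (f i).
Proof. exact: (big_morph _ (cd_mulDr y) ((cd_mul0 R n).2 y)). Qed.

Lemma cd_mul_one n : (forall x : cd R n, cd_mul (cd_one R n) x = x) /\
  (forall x : cd R n, cd_mul x (cd_one R n) = x).
Proof.
elim: n => [|n [IHl IHr]]; first by split=> x; [exact: mul1r|exact: mulr1].
by split=> -[a b] /=; rewrite ?cd_conj1 ?cd_conj0 !(IHl, IHr)
  !((cd_mul0 _ _).1, (cd_mul0 _ _).2) subr0 ?addr0 ?add0r.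
Qed.

Lemma cd_mul1l n (x : cd R n) : cd_mul (cd_one R n) x = x.
Proof. exact: (cd_mul_one n).1. Qed.

Lemma cd_mul1r n (x : cd R n) : cd_mul x (cd_one R n) = x.
Proof. exact: (cd_mul_one n).2. Qed.

Lemma cd_conjM n (x y : cd R n) :
  cd_conj (cd_mul x y) = cd_mul (cd_conj y) (cd_conj x).
Proof.
elim: n x y => [|n IH] x y; first exact: mulrC.
case: x y => [a b] [c d] /=; rewrite !cd_conjD !cd_conjN !IH !cd_conjK.
rewrite !(cd_mulNl, cd_mulNr) opprK opprD; congr (_, _); last by rewrite addrC.
Qed.

Lemma cd_reC n (x y : cd R n) : cd_re (cd_mul x y) = cd_re (cd_mul y x).
Proof.
elim: n x y => [|n IH] x y; first exact: mulrC.
case: x y => [a b] [c d] /=; rewrite !cd_reD !cd_reN IH; congr (_ - _).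
by rewrite -cd_re_conj cd_conjM cd_conjK.
Qed.

(** At every level the associator has zero real part, even though the product
    stops being associative at the octonions. *)
Lemma cd_reA n (x y z : cd R n) :
  cd_re (cd_mul (cd_mul x y) z) = cd_re (cd_mul x (cd_mul y z)).
Proof.
elim: n x y z => [|n IH] x y z; first by rewrite /= mulrA.
case: x y z => [a b] [c d] [e f] /=.
rewrite !(cd_conjD, cd_conjN, cd_conjM, cd_conjK, cd_mulDl, cd_mulDr, cd_mulNl,
  cd_mulNr, cd_reD, cd_reN) IH.
have -> : cd_re (cd_mul (cd_mul (cd_conj d) b) e) =
    cd_re (cd_mul (cd_mul e (cd_conj d)) b) by rewrite cd_reC -IH.
have -> : cd_re (cd_mul (cd_conj f) (cd_mul d a)) =
    cd_re (cd_mul a (cd_mul (cd_conj f) d)) by rewrite -IH cd_reC.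
have -> : cd_re (cd_mul (cd_conj f) (cd_mul b (cd_conj c))) =
    cd_re (cd_mul (cd_mul (cd_conj c) (cd_conj f)) b).
  by rewrite cd_reC IH cd_reC.
ring.
Qed.

Definition cd_dot n (x y : cd R n) : R := cd_re (cd_mul x (cd_conj y)).

Lemma cd_dotE n (x y : cd R n.+1) :
  cd_dot x y = cd_dot x.1 y.1 + cd_dot x.2 y.2.
Proof.
rewrite /cd_dot /=; rewrite cd_reD cd_reN cd_conjN cd_mulNl cd_reN opprK.
by congr (_ + _); rewrite cd_reC.
Qed.

Lemma cd_dotC n (x y : cd R n) : cd_dot x y = cd_dot y x.
Proof. by rewrite /cd_dot -cd_re_conj cd_conjM cd_conjK. Qed.

Lemma cd_dotDl n (x y z : cd R n) : cd_dot (x + y) z = cd_dot x z + cd_dot y z.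
Proof. by rewrite /cd_dot cd_mulDl cd_reD. Qed.

Lemma cd_dotDr n (x y z : cd R n) : cd_dot x (y + z) = cd_dot x y + cd_dot x z.
Proof. by rewrite !(cd_dotC x) cd_dotDl. Qed.

Lemma cd_dotZl n r (x y : cd R n) : cd_dot (r *: x) y = r * cd_dot x y.
Proof. by rewrite /cd_dot cd_mulZl cd_reZ. Qed.

Lemma cd_dotZr n r (x y : cd R n) : cd_dot x (r *: y) = r * cd_dot x y.
Proof. by rewrite cd_dotC cd_dotZl cd_dotC. Qed.

Lemma cd_dotNl n (x y : cd R n) : cd_dot (- x) y = - cd_dot x y.
Proof. by rewrite -scaleN1r cd_dotZl mulN1r. Qed.

Lemma cd_dotNr n (x y : cd R n) : cd_dot x (- y) = - cd_dot x y.
Proof. by rewrite -scaleN1r cd_dotZr mulN1r. Qed.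

Lemma cd_dot_ge0 n (x : cd R n) : 0 <= cd_dot x x.
Proof.
elim: n x => [x|n IH x]; first by rewrite /cd_dot /= -expr2 sqr_ge0.
by rewrite cd_dotE addr_ge0.
Qed.

Lemma cd_dot_eq0 n (x : cd R n) : cd_dot x x = 0 -> x = 0.
Proof.
elim: n x => [x|n IH [a b]].
  by rewrite /cd_dot /= => /eqP; rewrite mulf_eq0 orbb => /eqP.
rewrite cd_dotE /= => /eqP; rewrite paddr_eq0 ?cd_dot_ge0//.
by move=> /andP[/eqP/IH -> /eqP/IH ->].
Qed.

Lemma cd_dot_inj n (x y : cd R n) : (forall z, cd_dot x z = cd_dot y z) -> x = y.
Proof.
move=> xy; apply/eqP; rewrite -subr_eq0; apply/eqP/cd_dot_eq0.
by rewrite cd_dotDl cd_dotNl xy subrr.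
Qed.

Lemma cd_dot_conj n (x y : cd R n) : cd_dot (cd_conj x) (cd_conj y) = cd_dot x y.
Proof. by rewrite /cd_dot cd_conjK cd_reC -/(cd_dot y x) cd_dotC. Qed.

Lemma cd_dot1 n (x : cd R n) : cd_dot x (cd_one R n) = cd_re x.
Proof. by rewrite /cd_dot cd_conj1 cd_mul1r. Qed.

(** By [cd_reA] and [cd_reC], the adjoint of a multiplication operator is
    multiplication by the conjugate, at every level of the tower. *)
Lemma cd_dot_adjl n (x y z : cd R n) :
  cd_dot (cd_mul x y) z = cd_dot y (cd_mul (cd_conj x) z).
Proof. by rewrite /cd_dot cd_conjM cd_conjK cd_reA cd_reC cd_reA. Qed.

Lemma cd_dot_adjr n (x y z : cd R n) :
  cd_dot (cd_mul x y) z = cd_dot x (cd_mul z (cd_conj y)).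
Proof. by rewrite /cd_dot cd_conjM cd_conjK cd_reA. Qed.

Lemma cd_mulC1 n (x y : cd R n) : (n <= 1)%N -> cd_mul x y = cd_mul y x.
Proof.
case: n x y => [|[|//]] x y _; first exact: mulrC.
case: x y => [a b] [c d] /=; congr pair; first by rewrite mulrC [d * b]mulrC.
by rewrite addrC.
Qed.

(** In each component both sides expand to the same four terms, up to the order
    of the factors. *)
Lemma cd_mulA_step n :
  (forall x y : cd R n, cd_mul x y = cd_mul y x) ->
  (forall x y z : cd R n, cd_mul (cd_mul x y) z = cd_mul x (cd_mul y z)) ->
  forall x y z : cd R n.+1, cd_mul (cd_mul x y) z = cd_mul x (cd_mul y z).
Proof.
move=> C A [a b] [c d] [e f] /=; rewrite !(cd_conjD, cd_conjN, cd_conjM,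
  cd_conjK, cd_mulDl, cd_mulDr, cd_mulNl, cd_mulNr) !A.
have CA (x y z : cd R n) : cd_mul x (cd_mul y z) = cd_mul y (cd_mul x z).
  by rewrite -A [cd_mul x y]C A.
congr pair.
  rewrite !opprD -!addrA; congr (_ + _).
  rewrite addrC -addrA; congr (_ + (_ + _)); congr (- _).
  - by rewrite [RHS]CA [cd_mul a d]C.
  - by rewrite [RHS]CA [cd_mul (cd_conj c) b]C.
  - by rewrite [RHS]CA [cd_mul e b]C.
rewrite -!addrA; congr (_ + _); first by rewrite [cd_mul c a]C.
rewrite addrC -addrA; congr (_ + (_ + _)).
- by rewrite [cd_mul a _]C.
- by rewrite [cd_mul (cd_conj c) _]C.
- by congr (- _); rewrite [LHS]CA [RHS]C A.
Qed.

Lemma cd_mulA n (x y z : cd R n) : (n <= 2)%N ->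
  cd_mul (cd_mul x y) z = cd_mul x (cd_mul y z).
Proof.
have A0 (u v w : cd R 0) : cd_mul (cd_mul u v) w = cd_mul u (cd_mul v w).
  exact/esym/mulrA.
have A1 := cd_mulA_step (fun x y => @cd_mulC1 0 x y isT) A0.
have A2 := cd_mulA_step (fun x y => @cd_mulC1 1 x y isT) A1.
by case: n x y z => [|[|[|//]]] x y z _; [exact: A0|exact: A1|exact: A2].
Qed.

(** The cross terms of the norm of a product cancel by moving one factor across
    with the adjoint identities and reassociating. *)
Lemma cd_norm_step n :
  (forall x y z : cd R n, cd_mul (cd_mul x y) z = cd_mul x (cd_mul y z)) ->
  (forall x y : cd R n,
    cd_dot (cd_mul x y) (cd_mul x y) = cd_dot x x * cd_dot y y) ->
  forall x y : cd R n.+1,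
    cd_dot (cd_mul x y) (cd_mul x y) = cd_dot x x * cd_dot y y.
Proof.
move=> A N [a b] [c d]; rewrite !cd_dotE /=.
rewrite !(cd_dotDl, cd_dotDr, cd_dotNl, cd_dotNr) !N !cd_dot_conj.
rewrite [cd_dot (cd_mul (cd_conj d) b) (cd_mul a c)]cd_dotC.
rewrite [cd_dot (cd_mul b (cd_conj c)) (cd_mul d a)]cd_dotC.
have -> : cd_dot (cd_mul a c) (cd_mul (cd_conj d) b) =
          cd_dot (cd_mul d a) (cd_mul b (cd_conj c)).
  by rewrite -cd_dot_adjl -A cd_dot_adjr.
ring.
Qed.

(** Hurwitz: doubling an associative composition algebra gives a composition
    algebra, so the norm is multiplicative up to the octonions. *)
Lemma cd_normM n (x y : cd R n) : (n <= 3)%N ->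
  cd_dot (cd_mul x y) (cd_mul x y) = cd_dot x x * cd_dot y y.
Proof.
elim: n x y => [|n IH] x y n3; first by rewrite /cd_dot /=; ring.
apply: cd_norm_step => [u v w|u v]; first exact: cd_mulA.
by apply: IH; exact: ltnW.
Qed.

Lemma cd_norm1 n : cd_dot (cd_one R n) (cd_one R n) = 1.
Proof. by rewrite cd_dot1 cd_re1. Qed.

Lemma cd_mul_conj n (x : cd R n) :
  cd_mul x (cd_conj x) = cd_dot x x *: cd_one R n.
Proof.
elim: n x => [x|n IH [a b]]; first by rewrite /cd_dot; exact/esym/mulr1.
rewrite cd_dotE cd_pairZ /= scaler0 cd_conjN cd_conjK cd_mulNl opprK IH.
have := IH (cd_conj b); rewrite cd_conjK cd_dot_conj => ->.
by rewrite -scalerDl cd_mulNl addNr.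
Qed.

Lemma cd_conj_fix n (x : cd R n) : cd_conj x = x -> x = cd_re x *: cd_one R n.
Proof.
elim: n x => [x _|n IH [a b]]; first exact/esym/mulr1.
rewrite cd_pairZ scaler0 /= => -[/IH <- bN]; congr pair.
apply: cd_dot_eq0; apply/eqP; have := congr1 (cd_dot b) bN.
by rewrite cd_dotNr; lra.
Qed.

Lemma cd_conj_real n r : cd_conj (r *: cd_one R n) = r *: cd_one R n.
Proof. by rewrite cd_conjZ cd_conj1. Qed.

End CDAlgebra.

(** * Moufang identities *)

(** The identities below are consequences of the multiplicativity of the norm:
    polarizing it twice gives the exchange law [cd_dot_exchange], and products
    are then identified by pairing them with an arbitrary element. *)

Section Moufang.
Variables (R : realType) (n : nat).
Hypothesis n3 : (n <= 3)%N.
Implicit Types x y z t : cd R n.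
Local Notation "x ** y" := (cd_mul x y) (at level 40, left associativity).

Lemma cd_dot_scalel x y z : cd_dot (x ** y) (x ** z) = cd_dot x x * cd_dot y z.
Proof.
have := cd_normM x (y + z) n3; rewrite cd_mulDr !cd_dotDl !cd_dotDr.
rewrite !cd_normM// (cd_dotC (x ** z)) (cd_dotC z y); lra.
Qed.

Lemma cd_dot_exchange x y z t :
  cd_dot (x ** y) (z ** t) + cd_dot (x ** t) (z ** y) =
  2 * cd_dot x z * cd_dot y t.
Proof.
have := cd_dot_scalel (x + z) y t; rewrite !cd_mulDl !cd_dotDl !cd_dotDr.
rewrite !cd_dot_scalel (cd_dotC (z ** y)) (cd_dotC z x); lra.
Qed.

Lemma cd_mulKl x y : cd_conj x ** (x ** y) = cd_dot x x *: y.
Proof.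
apply: cd_dot_inj => z.
by rewrite cd_dot_adjl cd_conjK cd_dot_scalel cd_dotZl.
Qed.

Lemma cd_mulKr x y : (y ** x) ** cd_conj x = cd_dot x x *: y.
Proof.
apply: (can_inj (@cd_conjK R n)).
by rewrite !cd_conjM cd_mulKl cd_dot_conj cd_conjZ.
Qed.

(** The right-hand side depends on [y] and [z] only through their product; this
    is what makes the middle Moufang identity hold. *)
Lemma cd_moufang_aux x y z :
  (x ** y) ** (z ** x) =
  (2 * cd_dot (y ** z) (cd_conj x)) *: x - cd_dot x x *: cd_conj (y ** z).
Proof.
apply: cd_dot_inj => t.
rewrite cd_dot_adjr cd_conjM cd_dotDl cd_dotNl !cd_dotZl.
have := cd_dot_exchange x y t (cd_conj x ** cd_conj z).
have -> : x ** (cd_conj x ** cd_conj z) = cd_dot x x *: cd_conj z.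
  by have := cd_mulKl (cd_conj x) (cd_conj z); rewrite cd_conjK cd_dot_conj.
have -> : cd_dot y (cd_conj x ** cd_conj z) = cd_dot (y ** z) (cd_conj x).
  by rewrite cd_dot_adjr.
rewrite cd_dotZl cd_conjM.
have -> : cd_dot (cd_conj z) (t ** y) = cd_dot (cd_conj z ** cd_conj y) t.
  by rewrite cd_dot_adjr cd_conjK.
lra.
Qed.

Lemma cd_moufang x y z : (x ** y) ** (z ** x) = (x ** (y ** z)) ** x.
Proof.
have := cd_moufang_aux x (y ** z) (cd_one R n).
by rewrite cd_mul1l cd_mul1r cd_moufang_aux.
Qed.

Lemma cd_flexible x y : x ** (y ** x) = (x ** y) ** x.
Proof. by have := cd_moufang x (cd_one R n) y; rewrite cd_mul1r cd_mul1l. Qed.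

Lemma cd_moufangr x y z : ((z ** x) ** y) ** x = z ** ((x ** y) ** x).
Proof.
apply: cd_dot_inj => t.
rewrite cd_dot_adjr cd_dot_adjl cd_conjM cd_moufang.
by rewrite -[in RHS]cd_flexible [RHS]cd_dot_adjl [RHS]cd_dot_adjl [RHS]cd_dot_adjr.
Qed.

End Moufang.

(** * Projections as rank-one matrices *)

Lemma cd_level_le3 F : (cd_level F <= 3)%N.
Proof. by case: F. Qed.

Section RankOne.
Variables (R : realType) (F : scalars) (n : nat).
Local Notation K := (cd R (cd_level F)).
Local Notation M := 'M[K]_n.+1.
Local Notation "x ** y" := (cd_mul x y) (at level 40, left associativity).
Local Notation herm := (@Defs.hermitian R F n).
Local Notation one := (cd_one R (cd_level F)).
Implicit Types (A B P : M) (i j k l : 'I_n.+1).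

Lemma hdotE A B : hdot A B = \sum_i \sum_j cd_dot (A i j) (B i j).
Proof.
by rewrite /hdot cd_re_sum; apply: eq_bigr => i _; rewrite cd_re_sum.
Qed.

Lemma hermitian_diag P i : herm P -> P i i = cd_re (P i i) *: one.
Proof. by move=> h; apply: cd_conj_fix; rewrite -h. Qed.

Lemma hermitian_dot P i j : herm P ->
  cd_dot (P i j) (P i j) = cd_dot (P j i) (P j i).
Proof. by move=> h; rewrite (h i j) cd_dot_conj. Qed.

Lemma trace_re P : \tr P = one -> \sum_i cd_re (P i i) = 1.
Proof. by move=> /(congr1 (@cd_re R _)); rewrite cd_re1 /mxtrace cd_re_sum. Qed.

Definition rank1 P := forall i j k, P k j ** P j i = cd_re (P j j) *: P k i.

Lemma hermitian_re_sym P i j : herm P -> cd_re (P i j) = cd_re (P j i).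
Proof. by move=> h; rewrite (h i j) cd_re_conj. Qed.

Section Idempotent.
Variable P : M.
Hypotheses (hP : herm P) (PP : hmulmx P P = P).

Lemma idem_entry i j : \sum_k P i k ** P k j = P i j.
Proof. by have := congr1 (fun A : M => A i j) PP; rewrite mxE. Qed.

Lemma idem_col_norm i : \sum_k cd_dot (P k i) (P k i) = cd_re (P i i).
Proof.
rewrite -[in RHS]idem_entry cd_re_sum; apply: eq_bigr => k _.
by rewrite cd_reC (hP k i).
Qed.

(** The defect in the Cauchy-Schwarz inequality for two columns.  Reassociation
    is only needed under the real part. *)
Lemma idem_gap i j (a := cd_re (P j j)) :
  \sum_k cd_dot (a *: P k i - P k j ** P j i) (a *: P k i - P k j ** P j i) =
  a * (a * cd_re (P i i) - cd_dot (P i j) (P i j)).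
Proof.
transitivity (\sum_k (a * a * cd_dot (P k i) (P k i)
    - 2 * a * cd_re ((P i k ** P k j) ** P j i)
    + cd_dot (P k j) (P k j) * cd_dot (P j i) (P j i))).
  apply: eq_bigr => k _.
  rewrite !(cd_dotDl, cd_dotDr, cd_dotNl, cd_dotNr, cd_dotZl, cd_dotZr).
  rewrite (cd_dotC (P k i) (_ ** _)) (cd_normM _ _ (cd_level_le3 F)).
  rewrite [cd_dot (_ ** _) (P k i)]/cd_dot -(hP k i) cd_reC -cd_reA; ring.
rewrite big_split sumrB /= -!mulr_sumr -mulr_suml !idem_col_norm -cd_re_sum.
rewrite -cd_mul_suml idem_entry (hP i j) -/(cd_dot _ _) cd_dot_conj -/a; ring.
Qed.

Lemma idem_diag_ge0 i : 0 <= cd_re (P i i).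
Proof. by rewrite -idem_col_norm sumr_ge0// => k _; exact: cd_dot_ge0. Qed.

Lemma idem_cauchy i j :
  cd_dot (P i j) (P i j) <= cd_re (P j j) * cd_re (P i i).
Proof.
have [a0|a0] := eqVneq (cd_re (P j j)) 0; last first.
  have a_gt0 : 0 < cd_re (P j j) by rewrite lt_neqAle eq_sym a0 idem_diag_ge0.
  rewrite -subr_ge0 -(pmulr_rge0 _ a_gt0) -idem_gap.
  by apply: sumr_ge0 => k _; exact: cd_dot_ge0.
rewrite a0 mul0r -a0 -idem_col_norm (bigD1 i)//= lerDl.
by apply: sumr_ge0 => k _; exact: cd_dot_ge0.
Qed.

(** Summed over all pairs of columns, both sides of [idem_cauchy] equal 1.  So
    each instance is an equality, and the sum in [idem_gap] vanishes. *)
Lemma idem_rank1 : \tr P = one -> rank1 P.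
Proof.
move=> trP.
have gap0 i j : cd_re (P j j) * cd_re (P i i) - cd_dot (P i j) (P i j) = 0.
  have : \sum_i \sum_j (cd_re (P j j) * cd_re (P i i) - cd_dot (P i j) (P i j)) = 0.
    under eq_bigr => i0 _.
      rewrite sumrB -mulr_suml trace_re// mul1r.
      under eq_bigr => j0 _ do rewrite hermitian_dot//.
      rewrite idem_col_norm subrr; over.
    by rewrite big1.
  move/eqP; rewrite psumr_eq0; last first.
    by move=> i0 _; apply: sumr_ge0 => j0 _; rewrite subr_ge0 idem_cauchy.
  move=> /allP /(_ i (mem_index_enum _)) /eqP/eqP; rewrite psumr_eq0; last first.
    by move=> j0 _; rewrite subr_ge0 idem_cauchy.
  by move=> /allP /(_ j (mem_index_enum _)) /eqP.
move=> i j k; have /eqP := idem_gap i j; rewrite gap0 mulr0 psumr_eq0; last first.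
  by move=> k0 _; exact: cd_dot_ge0.
move=> /allP /(_ k (mem_index_enum _)) /eqP/cd_dot_eq0/eqP.
by rewrite subr_eq0 => /eqP.
Qed.

End Idempotent.

Lemma rank1_norm P i j : herm P -> rank1 P ->
  cd_dot (P i j) (P i j) = cd_re (P i i) * cd_re (P j j).
Proof.
move=> hP r1; have := congr1 (@cd_re R _) (r1 i j i).
by rewrite (hP i j) -/(cd_dot _ _) cd_reZ mulrC.
Qed.

Lemma projspaceP P :
  projspace R F n P <-> [/\ herm P, rank1 P & \tr P = one].
Proof.
split=> [[hP PP trP]|[hP r1 trP]]; first by split=> //; exact: idem_rank1.
split=> //; apply/matrixP => k i; rewrite mxE.
under eq_bigr => j _ do rewrite r1.
by rewrite -scaler_suml trace_re// scale1r.
Qed.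

(** * Isometries of the projective space *)

Definition proj_isometry (G : M -> M) : Prop :=
  (forall P, projspace R F n P -> projspace R F n (G P)) /\
  (forall A B, projspace R F n A -> projspace R F n B ->
     hdot (G A) (G B) = hdot A B).

(** The maps are defined on all matrices, so that they compose and cancel
    without membership proofs. *)
Definition same_orbit (P Q : M) : Prop :=
  exists G H : M -> M,
    [/\ proj_isometry G, proj_isometry H, cancel G H, cancel H G & G P = Q].

Lemma same_orbit_trans Q P S :
  same_orbit P Q -> same_orbit Q S -> same_orbit P S.
Proof.
move=> [G [H [[pG dG] [pH dH] GH HG GP]]] [G' [H' [[pG' dG'] [pH' dH'] GH' HG' GQ]]].
exists (G' \o G), (H \o H'); split.
- by split=> [A /pG/pG'//|A B pA pB /=]; rewrite dG' ?dG//; exact: pG.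
- by split=> [A /pH'/pH//|A B pA pB /=]; rewrite dH ?dH'//; exact: pH'.
- exact: can_comp.
- exact: can_comp.
- by rewrite /= GP.
Qed.

Lemma same_orbit_isometry (x y : projspace R F n) :
  same_orbit (set_val x) (set_val y) ->
  exists g : projspace R F n -> projspace R F n,
  [/\ Defs.isometry g,
      forall z t, hdot (set_val (g z)) (set_val (g t)) = hdot (set_val z) (set_val t)
    & g x = y].
Proof.
move=> [G [H [[pG dG] [pH _] GH HG Gx]]].
pose lift (T : M -> M) (pT : forall P, projspace R F n P -> projspace R F n (T P))
  (z : projspace R F n) : projspace R F n :=
  exist _ (T (set_val z)) (mem_set (pT _ (set_valP z))).
exists (lift G pG); split; last exact: val_inj; last first.
  by move=> z t; rewrite /= dG//; exact: set_valP.
split; first by exists (lift H pH) => z; apply: val_inj; rewrite /= ?GH ?HG.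
by move=> z t; rewrite /geodist /chordal /= dG//; exact: set_valP.
Qed.

(** A phase family rotates every off-diagonal entry by its own linear isometry.
    The multiplicativity asked for distinct indices is what keeps the rank-one
    relations; over the octonions it is an instance of triality. *)
Record phase (T : 'I_n.+1 -> 'I_n.+1 -> K -> K) : Prop := Phase {
  phaseZ : forall i j r x, T i j (r *: x) = r *: T i j x;
  phase_dot : forall i j x y, cd_dot (T i j x) (T i j y) = cd_dot x y;
  phase_conj : forall i j x, T j i (cd_conj x) = cd_conj (T i j x);
  phase_diag : forall i, T i i one = one;
  phaseM : forall i j k x y, i != j -> j != k -> i != k ->
    T k j x ** T j i y = T k i (x ** y) }.

Definition phase_mx (T : 'I_n.+1 -> 'I_n.+1 -> K -> K) P : M :=
  \matrix_(i, j) T i j (P i j).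

Lemma phase_isometry T : phase T -> proj_isometry (phase_mx T).
Proof.
move=> [TZ Td Tc T1 TM]; split=> [P /projspaceP[hP r1 trP]|A B _ _]; last first.
  by rewrite !hdotE; apply: eq_bigr => i _; apply: eq_bigr => j _; rewrite !mxE.
have Tdiag j : T j j (P j j) = P j j by rewrite hermitian_diag// TZ T1.
apply/projspaceP; split.
- by move=> i j; rewrite !mxE hP Tc.
- move=> i j k; rewrite !mxE Tdiag.
  have [->|ij] := eqVneq i j.
    rewrite Tdiag {1}(hermitian_diag j hP) cd_mulZr cd_mul1r.
    by congr (_ *: _).
  have [->|jk] := eqVneq j k.
    by rewrite Tdiag {1}(hermitian_diag k hP) cd_mulZl cd_mul1l.
  have [->|ik] := eqVneq i k.
    rewrite (hP k j) Tc cd_mul_conj Td Tdiag rank1_norm//.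
    by rewrite {2}(hermitian_diag k hP) scalerA mulrC.
  by rewrite TM// r1 TZ.
- by rewrite -trP; apply: eq_bigr => i _; rewrite mxE Tdiag.
Qed.

Lemma phase_orbit T T' P : phase T -> phase T' ->
  (forall i j, cancel (T i j) (T' i j)) -> (forall i j, cancel (T' i j) (T i j)) ->
  same_orbit P (phase_mx T P).
Proof.
move=> pT pT' TK T'K; exists (phase_mx T), (phase_mx T').
split=> //; try exact: phase_isometry.
- by move=> A; apply/matrixP => i j; rewrite !mxE TK.
- by move=> A; apply/matrixP => i j; rewrite !mxE T'K.
Qed.

Lemma assoc_phase (u : 'I_n.+1 -> K) : (cd_level F <= 2)%N ->
  (forall i, cd_dot (u i) (u i) = 1) ->
  phase (fun i j x => (u i ** x) ** cd_conj (u j)).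
Proof.
move=> l2 u1; have l3 := leqW l2; split.
- by move=> i j r x; rewrite cd_mulZr cd_mulZl.
- move=> i j x y; rewrite cd_dot_adjr cd_conjK.
  rewrite cd_mulA// -{2}(cd_conjK (u j)) cd_mulA//.
  have := cd_mul_conj (cd_conj (u j)); rewrite cd_conjK cd_dot_conj u1 scale1r.
  by move=> ->; rewrite cd_mul1r cd_dot_scalel// u1 mul1r.
- by move=> i j x; rewrite !cd_conjM cd_conjK cd_mulA.
- by move=> i; rewrite cd_mul1r cd_mul_conj u1 scale1r.
- move=> i j k x y _ _ _; rewrite !cd_mulA//; congr (_ ** (_ ** _)).
  rewrite -!cd_mulA//.
  have := cd_mul_conj (cd_conj (u j)); rewrite cd_conjK cd_dot_conj u1 scale1r.
  by move=> ->; rewrite cd_mul1l.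
Qed.

(** Conjugation by a real orthogonal matrix, split into a left and a right
    action: entries of [O] are real scalars, so each action commutes with the
    products on the other side and no associativity is involved. *)
Definition lact (O : 'M[R]_n.+1) P : M := \matrix_(i, j) \sum_k O i k *: P k j.
Definition ract (O : 'M[R]_n.+1) P : M := \matrix_(i, j) \sum_k O j k *: P i k.

Section Orthogonal.
Variable O : 'M[R]_n.+1.
Hypothesis Osym : forall i j, O i j = O j i.
Hypothesis OO : forall i j, \sum_k O k i * O k j = (i == j)%:R.

Lemma sum_delta (V : lmodType R) (f : 'I_n.+1 -> V) i :
  \sum_k (i == k)%:R *: f k = f i.
Proof.
rewrite (bigD1 i)//= eqxx scale1r big1 ?addr0// => k /negbTE.
by rewrite eq_sym => ->; rewrite scale0r.
Qed.

Lemma sum_orth (V : lmodType R) (f : 'I_n.+1 -> 'I_n.+1 -> V) :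
  \sum_i \sum_k \sum_l (O i k * O i l) *: f k l = \sum_k f k k.
Proof.
rewrite exchange_big; apply: eq_bigr => k _; rewrite exchange_big /=.
under eq_bigr => l _ do rewrite -scaler_suml OO.
exact: sum_delta.
Qed.

Lemma lact_ract P : lact O (ract O P) = ract O (lact O P).
Proof.
apply/matrixP => i j; rewrite !mxE.
under eq_bigr => k _ do rewrite mxE scaler_sumr.
rewrite exchange_big; apply: eq_bigr => l _; rewrite mxE scaler_sumr.
by apply: eq_bigr => k _; rewrite !scalerA mulrC.
Qed.

Lemma lactK : involutive (lact O).
Proof.
move=> P; apply/matrixP => i j; rewrite mxE.
under eq_bigr => k _ do rewrite mxE scaler_sumr.
rewrite exchange_big /=.
under eq_bigr => l _.
  under eq_bigr => k _ do rewrite scalerA Osym.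
  rewrite -scaler_suml OO; over.
exact: (sum_delta (fun l => P l j)).
Qed.

Lemma ractK : involutive (ract O).
Proof.
move=> P; apply/matrixP => i j; rewrite mxE.
under eq_bigr => k _ do rewrite mxE scaler_sumr.
rewrite exchange_big /=.
under eq_bigr => l _.
  under eq_bigr => k _ do rewrite scalerA Osym.
  rewrite -scaler_suml OO; over.
exact: (sum_delta (fun l => P i l)).
Qed.

Lemma hmulmx_lact A B : hmulmx (lact O A) B = lact O (hmulmx A B).
Proof.
apply/matrixP => i j; rewrite !mxE.
under eq_bigr => k _ do rewrite mxE cd_mul_suml.
rewrite exchange_big; apply: eq_bigr => l _; rewrite mxE scaler_sumr.
by apply: eq_bigr => k _; rewrite cd_mulZl.
Qed.

Lemma hmulmx_ract A B : hmulmx A (ract O B) = ract O (hmulmx A B).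
Proof.
apply/matrixP => i j; rewrite !mxE.
under eq_bigr => k _ do rewrite mxE cd_mul_sumr.
rewrite exchange_big; apply: eq_bigr => l _; rewrite mxE scaler_sumr.
by apply: eq_bigr => k _; rewrite cd_mulZr.
Qed.

Lemma hmulmx_orth A B : hmulmx (ract O A) (lact O B) = hmulmx A B.
Proof.
apply/matrixP => i j; rewrite !mxE.
rewrite -(sum_orth (fun k l => A i k ** B l j)).
apply: eq_bigr => m _; rewrite !mxE cd_mul_suml; apply: eq_bigr => k _.
rewrite cd_mulZl cd_mul_sumr scaler_sumr; apply: eq_bigr => l _.
by rewrite cd_mulZr scalerA.
Qed.

Definition orth_conj P : M := lact O (ract O P).

Lemma orth_conjK : involutive orth_conj.
Proof. by move=> P; rewrite /orth_conj -lact_ract lactK ractK. Qed.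

Lemma orth_conjE P i j : orth_conj P i j = \sum_k \sum_l (O i k * O j l) *: P k l.
Proof.
rewrite mxE; apply: eq_bigr => k _; rewrite mxE scaler_sumr.
by apply: eq_bigr => l _; rewrite scalerA.
Qed.

Lemma lact_dot A B :
  \sum_i \sum_j cd_dot (lact O A i j) (lact O B i j) =
  \sum_i \sum_j cd_dot (A i j) (B i j).
Proof.
rewrite exchange_big [RHS]exchange_big; apply: eq_bigr => j _ /=.
rewrite -(@sum_orth R^o (fun k l => cd_dot (A k j) (B l j))).
apply: eq_bigr => m _; rewrite !mxE /cd_dot cd_mul_suml cd_re_sum.
apply: eq_bigr => k _.
rewrite cd_mulZl cd_reZ cd_conj_sum cd_mul_sumr cd_re_sum mulr_sumr.
by apply: eq_bigr => l _; rewrite cd_conjZ cd_mulZr cd_reZ mulrA.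
Qed.

Lemma ract_dot A B :
  \sum_i \sum_j cd_dot (ract O A i j) (ract O B i j) =
  \sum_i \sum_j cd_dot (A i j) (B i j).
Proof.
apply: eq_bigr => j _ /=.
rewrite -(@sum_orth R^o (fun k l => cd_dot (A j k) (B j l))).
apply: eq_bigr => m _; rewrite !mxE /cd_dot cd_mul_suml cd_re_sum.
apply: eq_bigr => k _.
rewrite cd_mulZl cd_reZ cd_conj_sum cd_mul_sumr cd_re_sum mulr_sumr.
by apply: eq_bigr => l _; rewrite cd_conjZ cd_mulZr cd_reZ mulrA.
Qed.

Lemma orth_conj_isometry : proj_isometry orth_conj.
Proof.
split=> [P [hP PP trP]|A B _ _]; last by rewrite !hdotE lact_dot ract_dot.
split.
- move=> i j; rewrite !orth_conjE cd_conj_sum exchange_big.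
  apply: eq_bigr => k _; rewrite cd_conj_sum; apply: eq_bigr => l _.
  by rewrite cd_conjZ -hP mulrC.
- rewrite /orth_conj hmulmx_lact; congr (lact O _).
  by rewrite lact_ract hmulmx_ract hmulmx_orth PP.
- rewrite -trP /mxtrace -(sum_orth (fun k l => P k l)).
  by apply: eq_bigr => i _; rewrite orth_conjE.
Qed.

Lemma orth_conj_orbit P : same_orbit P (orth_conj P).
Proof.
by exists orth_conj, orth_conj; split=> //; first [exact: orth_conj_isometry|
  exact: orth_conjK].
Qed.

End Orthogonal.

End RankOne.

(** * Transitivity *)

Section Transitivity.
Variables (R : realType) (F : scalars) (n : nat).
Local Notation K := (cd R (cd_level F)).
Local Notation M := 'M[K]_n.+1.
Local Notation "x ** y" := (cd_mul x y) (at level 40, left associativity).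
Local Notation one := (cd_one R (cd_level F)).
Local Notation herm := (@Defs.hermitian R F n).
Implicit Types (A B P : M) (i j k l : 'I_n.+1) (u v w : 'I_n.+1 -> R).

(** If [u] and [v] differ, the reflection along [v - u] works; its off-diagonal entries vanish at the
    indices where [u] and [v] agree, which [kill_last] uses to leave one
    coordinate untouched. *)
Lemma householder u v : \sum_i v i ^+ 2 = \sum_i u i ^+ 2 ->
  exists O : 'M[R]_n.+1,
  [/\ forall i j, O i j = O j i,
      forall i j, \sum_k O k i * O k j = (i == j)%:R,
      forall i j, i != j -> v j = u j -> O i j = 0 &
      forall i, \sum_k O i k * v k = u i].
Proof.
move=> vu.
pose D := \sum_i (v i - u i) ^+ 2.
pose O : 'M[R]_n.+1 :=
  \matrix_(i, j) ((i == j)%:R - (v i - u i) * (v j - u j) * (2 / D)).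
have sd (i : 'I_n.+1) (f : 'I_n.+1 -> R) : \sum_k (i == k)%:R * f k = f i.
  by rewrite -[RHS](@sum_delta R n R^o f i).
have [D0|D0] := eqVneq D 0.
  have vu0 i : v i - u i = 0.
    have /eqP := D0; rewrite psumr_eq0 => [/allP /(_ i (mem_index_enum _))|j _].
      by rewrite /= sqrf_eq0 => /eqP.
    exact: sqr_ge0.
  exists 1%:M; split.
  - by move=> i j; rewrite !mxE eq_sym.
  - move=> i j; under eq_bigr => k _ do rewrite !mxE (eq_sym k i).
    by rewrite -[RHS](sd i (fun k => (k == j)%:R)).
  - by move=> i j /negbTE ij _; rewrite mxE ij.
  - move=> i; under eq_bigr do rewrite mxE.
    by rewrite sd; apply/eqP; rewrite -subr_eq0 vu0.
have dv : \sum_k (v k - u k) * v k = D / 2.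
  have : (\sum_k (v k - u k) * v k) - D / 2 = ((\sum_i v i ^+ 2) - \sum_i u i ^+ 2) / 2.
    rewrite /D mulr_suml -!sumrB mulr_suml; by apply: eq_bigr => k _; field.
  by rewrite vu subrr mul0r => /eqP; rewrite subr_eq0 => /eqP.
exists O; split.
- by move=> i j; rewrite !mxE eq_sym; congr (_ - _); ring.
- move=> i j.
  transitivity (\sum_k ((i == k)%:R * (j == k)%:R
    - (i == k)%:R * ((v k - u k) * (v j - u j) * (2 / D))
    - (j == k)%:R * ((v k - u k) * (v i - u i) * (2 / D))
    + (v k - u k) ^+ 2 * ((v i - u i) * (v j - u j) * (2 / D) ^+ 2))).
    by apply: eq_bigr => k _; rewrite !mxE (eq_sym k i) (eq_sym k j); ring.
  rewrite big_split /= !sumrB !sd -mulr_suml -/D eq_sym; field.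
  by rewrite D0.
- by move=> i j /negbTE ij e; rewrite mxE ij e subrr mulr0 mul0r subr0.
- move=> i; transitivity (\sum_k ((i == k)%:R * v k
     - (v k - u k) * v k * ((v i - u i) * (2 / D)))).
    by apply: eq_bigr => k _; rewrite mxE; ring.
  by rewrite sumrB sd -mulr_suml dv; field; rewrite D0.
Qed.

Definition real_mx P := forall i j, P i j = cd_re (P i j) *: one.

Lemma hermitian_real P i j : herm P ->
  P i j = cd_re (P i j) *: one -> P j i = cd_re (P j i) *: one.
Proof. by move=> hP Pij; rewrite (hP i j) Pij cd_conj_real cd_reZ cd_re1 mulr1. Qed.

Lemma diag_ge0 P i : projspace R F n P -> 0 <= cd_re (P i i).
Proof. by case=> hP PP _; exact: idem_diag_ge0. Qed.

Lemma diag_pos P : projspace R F n P -> exists j, 0 < cd_re (P j j).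
Proof.
move=> pP; have [_ _ trP] := pP; apply: contrapT => /forallNP nP.
have := trace_re trP; rewrite big1 => [/esym/eqP|j _]; first by rewrite oner_eq0.
by apply/eqP; rewrite eq_le diag_ge0// andbT leNgt; exact/negP.
Qed.

Lemma orbit_projspace P Q : same_orbit P Q -> projspace R F n P -> projspace R F n Q.
Proof. by move=> [G [H [[pG _] _ _ _ <-]]] /pG. Qed.

Lemma real_rank1 P j : projspace R F n P -> real_mx P -> 0 < cd_re (P j j) ->
  exists v, \sum_i v i ^+ 2 = 1 /\ forall k l, P k l = (v k * v l) *: one.
Proof.
move=> /projspaceP[hP r1 trP] rP j0.
have s0 : Num.sqrt (cd_re (P j j)) != 0 by rewrite sqrtr_eq0 -ltNge.
exists (fun k => cd_re (P k j) / Num.sqrt (cd_re (P j j))).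
have e k l : P k l =
    (cd_re (P k j) / Num.sqrt (cd_re (P j j)) * (cd_re (P l j) / Num.sqrt (cd_re (P j j)))) *: one.
  have := r1 l j k; rewrite (rP k j) (rP j l) cd_mulZl cd_mulZr cd_mul1l.
  move=> /(congr1 (fun x => (cd_re (P j j))^-1 *: x)).
  rewrite !scalerA mulVf ?gt_eqF// scale1r => <-; congr (_ *: _).
  rewrite (hermitian_re_sym j l hP) ?cd_reZ ?cd_re1 ?mulr1.
  rewrite -{1}(sqr_sqrtr (ltW j0)); field.
  by rewrite s0.
split=> //; rewrite -(trace_re trP); apply: eq_bigr => k _.
by rewrite [in RHS]e cd_reZ cd_re1 mulr1 expr2.
Qed.

(** A real projection is v v^T with v a unit vector, and a reflection sends v to
    the first basis vector. *)
Lemma real_orbit P : projspace R F n P -> real_mx P ->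
  same_orbit P (projspace_pt R F n).
Proof.
move=> pP rP; have [j j0] := diag_pos pP.
have [v [v1 Pv]] := real_rank1 pP rP j0.
have [|O [Os OO _ Ov]] := @householder (fun i => (i == 0)%:R) v.
  rewrite v1 (bigD1 0)//= ?eqxx big1 ?addr0 ?expr1n// => i /negbTE ->.
  by rewrite expr0n.
have -> : projspace_pt R F n = orth_conj O P; last exact: orth_conj_orbit.
apply/matrixP => a b; rewrite orth_conjE mxE.
under [RHS]eq_bigr => k _.
  under eq_bigr => l _ do rewrite Pv scalerA mulrACA.
  rewrite -scaler_suml -mulr_sumr Ov; over.
rewrite -scaler_suml -mulr_suml Ov -natrM mulnb.
by case: ifP => _; rewrite ?scale1r ?scale0r.
Qed.

Lemma unit_phase (a : K) :
  exists u : K, cd_dot u u = 1 /\ u ** a = cd_re (u ** a) *: one.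
Proof.
have [->|a0] := eqVneq a 0.
  exists one; rewrite cd_norm1; split=> //.
  by rewrite (cd_mul0 _ _).2 cd_re0 scale0r.
have d0 : 0 < cd_dot a a.
  rewrite lt_neqAle cd_dot_ge0 andbT eq_sym.
  by apply: contra a0 => /eqP/cd_dot_eq0 ->.
exists ((Num.sqrt (cd_dot a a))^-1 *: cd_conj a); split.
  rewrite cd_dotZl cd_dotZr cd_dot_conj mulrA -expr2 exprVn sqr_sqrtr ?ltW//.
  by rewrite mulVf ?gt_eqF.
rewrite cd_mulZl; have := cd_mul_conj (cd_conj a); rewrite cd_conjK => ->.
by rewrite !cd_reZ cd_re1 mulr1 scalerA.
Qed.

(** All entries become real at once when each index is rotated by the phase of
    its entry in a column whose diagonal entry is nonzero. *)
Lemma assoc_orbit P : (cd_level F <= 2)%N -> projspace R F n P ->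
  same_orbit P (projspace_pt R F n).
Proof.
move=> l2 pP; have [/projspaceP[hP r1 trP] [j j0]] := (pP, diag_pos pP).
have [u uP] := boolp.choice (fun i => unit_phase (P i j)).
have u1 i := (uP i).1; have uc i : cd_conj (u i) ** u i = one.
  by have := cd_mul_conj (cd_conj (u i)); rewrite cd_conjK cd_dot_conj u1 scale1r.
have cu i : u i ** cd_conj (u i) = one by rewrite cd_mul_conj u1 scale1r.
pose T i j x : K := (u i ** x) ** cd_conj (u j).
pose T' i j x : K := (cd_conj (u i) ** x) ** cd_conj (cd_conj (u j)).
have oT : same_orbit P (phase_mx T P).
  apply: (@phase_orbit _ _ _ T T').
  - exact: assoc_phase.
  - by apply: assoc_phase => // i; rewrite cd_dot_conj u1.
  - move=> a b x; rewrite /T /T' cd_conjK !cd_mulA// uc cd_mul1r -cd_mulA// uc.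
    by rewrite cd_mul1l.
  - move=> a b x; rewrite /T /T' cd_conjK !cd_mulA// cu cd_mul1r -cd_mulA// cu.
    by rewrite cd_mul1l.
apply: (same_orbit_trans oT); apply: real_orbit; first exact: orbit_projspace pP.
move=> k i; rewrite mxE /T.
have -> : P k i = (cd_re (P j j))^-1 *: (P k j ** P j i).
  by rewrite r1 scalerA mulVf ?gt_eqF// scale1r.
rewrite cd_mulZr cd_mulZl -cd_mulA// cd_mulA// (uP k).2.
have -> : P j i ** cd_conj (u i) = cd_conj (u i ** P i j) by rewrite cd_conjM -hP.
by rewrite (uP i).2 cd_conj_real cd_mulZl cd_mulZr cd_mul1l !cd_reZ cd_re1 mulr1
  !scalerA !mulrA.
Qed.

End Transitivity.

(** * The octonionic plane *)

Section OctonionicPlane.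
Variables (R : realType) (F : scalars).
Local Notation K := (cd R (cd_level F)).
Local Notation M := 'M[K]_3.
Local Notation "x ** y" := (cd_mul x y) (at level 40, left associativity).
Local Notation one := (cd_one R (cd_level F)).
Local Notation herm := (@Defs.hermitian R F 2).
Implicit Types (P : M) (u x y z : K).
Let l3 := cd_level_le3 F.

(** The phase rotation by [u] of the entry of index [(a, b)]: on the entries
    (1,2), (2,0), (0,1) it is left, right, and inverse two-sided multiplication,
    and conjugation determines the other three. *)
Definition triality u (a b : nat) x : K :=
  match a, b with
  | 1, 2 => u ** x
  | 2, 1 => x ** cd_conj u
  | 2, 0 => x ** u
  | 0, 2 => cd_conj u ** x
  | 0, 1 => (cd_conj u ** x) ** cd_conj u
  | 1, 0 => (u ** x) ** u
  | _, _ => x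
  end.

Lemma cd_dot_scaler x y z : cd_dot (y ** x) (z ** x) = cd_dot x x * cd_dot y z.
Proof. by rewrite cd_dot_adjr cd_mulKr// cd_dotZr. Qed.

Lemma cd_moufangl x y z : ((x ** y) ** x) ** z = x ** (y ** (x ** z)).
Proof.
apply: (can_inj (@cd_conjK R _)).
by rewrite -cd_flexible// !cd_conjM cd_moufangr.
Qed.

Lemma trialityK u a b : cd_dot u u = 1 ->
  cancel (triality u a b) (triality (cd_conj u) a b).
Proof.
move=> u1 x.
have ul y : cd_conj u ** (u ** y) = y by rewrite cd_mulKl// u1 scale1r.
have lu y : u ** (cd_conj u ** y) = y.
  by have := cd_mulKl l3 (cd_conj u) y; rewrite cd_conjK cd_dot_conj u1 scale1r.
have ur y : (y ** u) ** cd_conj u = y by rewrite cd_mulKr// u1 scale1r.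
have ru y : (y ** cd_conj u) ** u = y.
  by have := cd_mulKr l3 (cd_conj u) y; rewrite cd_conjK cd_dot_conj u1 scale1r.
case: a b => [|[|[|?]]] [|[|[|?]]] //=; rewrite ?cd_conjK //.
  by rewrite -(cd_flexible l3 (cd_conj u)) lu ru.
by rewrite -(cd_flexible l3 u) ul ur.
Qed.

Lemma triality_dot u a b x y : cd_dot u u = 1 ->
  cd_dot (triality u a b x) (triality u a b y) = cd_dot x y.
Proof.
move=> u1; have u1' : cd_dot (cd_conj u) (cd_conj u) = 1 by rewrite cd_dot_conj.
by case: a b => [|[|[|?]]] [|[|[|?]]] //=;
  rewrite ?(cd_dot_scaler, cd_dot_scalel l3) ?u1 ?u1' ?mul1r.
Qed.

(** The three Moufang identities say that left, right and two-sided
    multiplication by a unit octonion are related by triality. *)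
Lemma trialityM u a b c x y : cd_dot u u = 1 ->
  (a < 3)%N -> (b < 3)%N -> (c < 3)%N -> a != b -> b != c -> a != c ->
  triality u c b x ** triality u b a y = triality u c a (x ** y).
Proof.
move=> u1.
have ul y' : cd_conj u ** (u ** y') = y' by rewrite cd_mulKl// u1 scale1r.
have lu y' : u ** (cd_conj u ** y') = y'.
  by have := cd_mulKl l3 (cd_conj u) y'; rewrite cd_conjK cd_dot_conj u1 scale1r.
have ur y' : (y' ** u) ** cd_conj u = y' by rewrite cd_mulKr// u1 scale1r.
have ru y' : (y' ** cd_conj u) ** u = y'.
  by have := cd_mulKr l3 (cd_conj u) y'; rewrite cd_conjK cd_dot_conj u1 scale1r.
case: a b c => [|[|[|//]]] [|[|[|//]]] [|[|[|//]]] //= _ _ _ _ _ _.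
- by rewrite -(cd_moufangr l3 u) ru.
- by rewrite cd_moufang.
- by rewrite -(cd_moufangr l3 (cd_conj u)) ur.
- by rewrite cd_moufang.
- by rewrite cd_moufangl lu.
- by rewrite cd_moufangl ul.
Qed.

Lemma triality_phase u (f : 'I_3 -> nat) : cd_dot u u = 1 -> injective f ->
  (forall i, (f i < 3)%N) -> @phase R F 2 (fun i j => triality u (f i) (f j)).
Proof.
move=> u1 f_inj f3; split.
- move=> i j r x; case: (f i) (f j) => [|[|[|?]]] [|[|[|?]]] //=;
  by rewrite !(cd_mulZl, cd_mulZr).
- by move=> i j x y; exact: triality_dot.
- move=> i j x; case: (f i) (f j) => [|[|[|?]]] [|[|[|?]]] //=;
  by rewrite ?cd_conjM ?cd_conjK ?cd_flexible.
- by move=> i; case: (f i) => [|[|[|?]]].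
- by move=> i j k x y ij jk ik; apply: trialityM; rewrite ?(inj_eq f_inj).
Qed.

Lemma triality_orbit P u (f : 'I_3 -> nat) : cd_dot u u = 1 -> injective f ->
  (forall i, (f i < 3)%N) ->
  same_orbit P (phase_mx (fun i j => triality u (f i) (f j)) P).
Proof.
move=> u1 f_inj f3.
apply: (@phase_orbit _ _ _ _ (fun i j => triality (cd_conj u) (f i) (f j))).
- exact: triality_phase.
- by apply: triality_phase => //; rewrite cd_dot_conj.
- by move=> i j; exact: trialityK.
- move=> i j x; rewrite -{1}(cd_conjK u); apply: trialityK.
  by rewrite cd_dot_conj.
Qed.

Let o0 : 'I_3 := Ordinal (isT : (0 < 3)%N).
Let o1 : 'I_3 := Ordinal (isT : (1 < 3)%N).
Let o2 : 'I_3 := Ordinal (isT : (2 < 3)%N).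

Lemma sum3 (V : nmodType) (f : 'I_3 -> V) : \sum_i f i = f o0 + f o1 + f o2.
Proof.
rewrite !big_ord_recl big_ord0 addr0 addrA; congr (f _ + f _ + f _); exact: val_inj.
Qed.

(** When the (1,2) entry is real, the lower 2 by 2 block is real of rank one,
    hence v v^T up to scale; moving v onto the middle axis empties the last
    diagonal entry. *)
Lemma kill_last P : projspace R F 2 P -> P o1 o2 = cd_re (P o1 o2) *: one ->
  exists2 Q, same_orbit P Q & cd_re (Q o2 o2) = 0.
Proof.
move=> pP s_real; have /projspaceP[hP r1 trP] := pP.
set s := cd_re (P o1 o2) in s_real; set p := cd_re (P o2 o2).
have [p0|p0] := eqVneq p 0.
  exists P => //; exists id, id; split=> //; split=> //.
pose v (i : 'I_3) := match val i with 1 => s | 2 => p | _ => 0 end.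
pose w (i : 'I_3) := if val i == 1%N then Num.sqrt (s ^+ 2 + p ^+ 2) else 0.
(* [v] is the last column without its first entry, and [w] is its rotation
   onto the middle axis. *)
have [|O [Os OO O0 Ov]] := @householder R 2 w v.
  rewrite !sum3 /= /v /w /= sqr_sqrtr ?addr_ge0 ?sqr_ge0// !expr0n /=.
  by rewrite add0r addr0 add0r.
exists (orth_conj O P); first exact: orth_conj_orbit.
have O20 : O o2 o0 = 0 by apply: O0.
have := Ov o2; rewrite sum3 /v /w /= mulr0 add0r => Ov2.
have P22 : P o2 o2 = p *: one by exact: hermitian_diag.
have P21 : P o2 o1 = s *: one by rewrite (hP o1 o2) s_real cd_conj_real.
have P11 : P o1 o1 = (s * s / p) *: one.
  have := r1 o1 o2 o1; rewrite P21 s_real cd_mulZl cd_mulZr cd_mul1l -/p.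
  move=> /(congr1 (fun x => p^-1 *: x)); rewrite !scalerA mulVf// scale1r => <-.
  by congr (_ *: _); rewrite mulrC.
rewrite orth_conjE !sum3 O20 !(mul0r, mulr0, scale0r, add0r, addr0).
rewrite P22 P21 s_real P11 !(cd_reD, cd_reZ) cd_re1.
transitivity ((O o2 o1 * s + O o2 o2 * p) ^+ 2 / p); last by rewrite Ov2 expr0n /= mul0r.
by field.
Qed.

(** A rotation [triality] makes one chosen off-diagonal entry real.  A real
    reflection then leaves a 2 by 2 block with a single off-diagonal entry, whose
    phase is removed by the same rotation after a cyclic shift of the indices. *)
Lemma octonion_orbit P : projspace R F 2 P -> same_orbit P (projspace_pt R F 2).
Proof.
move=> pP; have [u [u1 uP]] := unit_phase (P o1 o2).
have o1P := @triality_orbit P u val u1 val_inj (@ltn_ord 3).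
apply: (same_orbit_trans o1P); have pP1 := orbit_projspace o1P pP.
have [|Q oQ Q22] := kill_last pP1; first by rewrite mxE.
apply: (same_orbit_trans oQ); have pQ := orbit_projspace oQ pP1.
have /projspaceP[hQ r1 trQ] := pQ.
have Q2 i : Q i o2 = 0.
  by apply: cd_dot_eq0; rewrite rank1_norm// Q22 mulr0.
have [w [w1 wQ]] := unit_phase (Q o0 o1).
pose f (i : 'I_3) := (i.+1 %% 3)%N.
have f_inj : injective f.
  by move=> [[|[|[|//]]] hi] [[|[|[|//]]] hj] //= _; exact: val_inj.
have f3 (i : 'I_3) : (f i < 3)%N by rewrite ltn_pmod.
have o2P := @triality_orbit Q w f w1 f_inj f3.
apply: (same_orbit_trans o2P); have pS := orbit_projspace o2P pQ.
apply: real_orbit => //; have /projspaceP[hS _ _] := pS.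
have S2 i : phase_mx (fun i j => triality w (f i) (f j)) Q i o2 =
    cd_re (phase_mx (fun i j => triality w (f i) (f j)) Q i o2) *: one.
  rewrite mxE Q2 -(scale0r 0).
  rewrite (phaseZ (triality_phase w1 f_inj f3)).
  by rewrite scale0r cd_re0 scale0r.
have S01 : phase_mx (fun i j => triality w (f i) (f j)) Q o0 o1 =
    cd_re (phase_mx (fun i j => triality w (f i) (f j)) Q o0 o1) *: one.
  by rewrite mxE.
move: (phase_mx _ Q) hS S2 S01 => S hS S2 S01 i j.
have [->|ij] := eqVneq i j; first exact: hermitian_diag.
have [->|j2] := eqVneq j o2; first exact: S2.
have [->|i2] := eqVneq i o2; first exact: hermitian_real hS (S2 j).
have {i j ij i2 j2} [[-> ->]|[-> ->]] : (i = o0 /\ j = o1) \/ (i = o1 /\ j = o0).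
- case: i j ij i2 j2 => [[|[|[|//]]] hi] [[|[|[|//]]] hj] //= _ _ _.
    by left; split; apply: val_inj.
  by right; split; apply: val_inj.
- exact: S01.
- exact: hermitian_real hS S01.
Qed.

End OctonionicPlane.

Section Transitive.
Variables (R : realType) (F : scalars) (n : nat).
Hypothesis hO : F = Octonions -> n = 2%N.

Lemma projspace_transitive (x : projspace R F n) :
  exists g : projspace R F n -> projspace R F n,
  [/\ Defs.isometry g,
      forall z t, hdot (set_val (g z)) (set_val (g t)) = hdot (set_val z) (set_val t)
    & g x = (point : set_type (projspace R F n))].
Proof.
apply: same_orbit_isometry; have pP := set_valP x.
move: hO x pP; case: F => hO' x pP; try exact: assoc_orbit.
by move: hO' x pP => /(_ erefl) -> x pP; exact: octonion_orbit.
Qed.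

End Transitive.

(** * Vectors given by coordinate functions *)

Section InnerProduct.
Variables (R : realType) (T : Type) (I : finType) (phi : I -> T -> R).

Definition inner (x y : T) : R := \sum_e phi e x * phi e y.

Lemma inner_sym x y : inner x y = inner y x.
Proof. by apply: eq_bigr => e _; rewrite mulrC. Qed.

Hypothesis unit_norm : forall x, inner x x = 1.

Lemma dist_inner x y : \sum_e (phi e x - phi e y) ^+ 2 = 2 * (1 - inner x y).
Proof.
transitivity (\sum_e (phi e x * phi e x + phi e y * phi e y
   - 2 * (phi e x * phi e y))).
  by apply: eq_bigr => e _; ring.
rewrite sumrB big_split /= -mulr_sumr -/(inner x x) -/(inner y y).
by rewrite -/(inner x y) !unit_norm; ring.
Qed.

Lemma inner_le1 x y : inner x y <= 1.
Proof.
have : 0 <= 2 * (1 - inner x y).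
  by rewrite -dist_inner; apply: sumr_ge0 => e _; exact: sqr_ge0.
lra.
Qed.

Lemma coord_range e x : -1 <= phi e x <= 1.
Proof.
have := unit_norm x; rewrite /inner (bigD1 e)//= => h.
have : 0 <= \sum_(i | i != e) phi i x * phi i x.
  by apply: sumr_ge0 => i _; rewrite -expr2 sqr_ge0.
by move=> h2; apply/andP; nra.
Qed.

End InnerProduct.

(** * Real coordinates on the projective space *)

Fixpoint cd_idx (n : nat) : finType :=
  if n is m.+1 then (cd_idx m + cd_idx m)%type else unit.

Section Coordinates.
Variable R : realType.

Fixpoint cd_coord n : cd_idx n -> cd R n -> R :=
  match n return cd_idx n -> cd R n -> R with
  | 0 => fun _ x => x
  | m.+1 => fun c x =>
      match c with inl c => cd_coord c x.1 | inr c => cd_coord c x.2 end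
  end.

Lemma cd_dot_coord n (x y : cd R n) :
  cd_dot x y = \sum_c cd_coord c x * cd_coord c y.
Proof.
elim: n x y => [|n IH] x y; first by rewrite (big_pred1 tt)//; case.
by rewrite cd_dotE !IH big_sumType.
Qed.

Lemma cd_coord_continuous n c : continuous (@cd_coord n c).
Proof.
elim: n c => [|n IH] c x; first exact: cvg_id.
case: c => c.
  apply: (@continuous_comp _ _ _ fst (cd_coord c)); [exact: cvg_fst|exact: IH].
apply: (@continuous_comp _ _ _ snd (cd_coord c)); [exact: cvg_snd|exact: IH].
Qed.

Lemma cd_coord_ball n (x y : cd R n) (e : R) :
  (forall c, `|cd_coord c x - cd_coord c y| < e) -> ball x e y.
Proof.
elim: n x y => [|n IH] x y xy; first exact: (xy tt).
by split; apply: IH => c; [exact: (xy (inl c))|exact: (xy (inr c))].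
Qed.

Variables (F : scalars) (n : nat).
Local Notation X := (set_type (projspace R F n)).
Local Notation T := (borel_projspace R F n).

Definition proj_idx : finType := ('I_n.+1 * 'I_n.+1 * cd_idx (cd_level F))%type.

Definition proj_coord (e : proj_idx) (x : X) : R :=
  cd_coord e.2 (set_val x e.1.1 e.1.2).

Definition overlap (x y : X) : R := hdot (set_val x) (set_val y).

Lemma overlap_coord x y : overlap x y = inner proj_coord x y.
Proof.
rewrite /overlap /inner hdotE pair_big /=.
rewrite -(pair_bigA _ (fun ij c => cd_coord c (set_val x ij.1 ij.2) *
  cd_coord c (set_val y ij.1 ij.2))) /=.
by apply: eq_bigr => -[i j] _; rewrite cd_dot_coord.
Qed.

Lemma overlapxx x : overlap x x = 1.
Proof.
have [hP PP trP] := set_valP x; rewrite /overlap hdotE exchange_big /=.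
by under eq_bigr do rewrite idem_col_norm//; rewrite trace_re.
Qed.

Lemma proj_coord_continuous e : continuous (proj_coord e : X -> R).
Proof.
move=> x; apply: (@continuous_comp _ _ _ (set_val : X -> _)
  (fun A : 'M[cd R (cd_level F)]_n.+1 => cd_coord e.2 (A e.1.1 e.1.2))).
  exact: (@initial_continuous X _ set_val).
apply: (@continuous_comp _ _ _
  (fun A : 'M[cd R (cd_level F)]_n.+1 => A e.1.1 e.1.2) (cd_coord e.2)).
  move=> s /(nbhs_ballP (_ : cd R _)) [d d0 ds].
  by apply/nbhs_ballP; exists d => //= N [_ MN]; exact/ds/MN.
exact: cd_coord_continuous.
Qed.

Lemma proj_coord_nbhs (x : X) (U : set X) : nbhs x U ->
  exists2 d : R, 0 < d &
  forall y, (forall e, `|proj_coord e x - proj_coord e y| < d) -> U y.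
Proof.
rewrite nbhsE => -[_ [[V oV <-] Vx] VU].
have /nbhs_ballP [d d0 dV] : nbhs (set_val x) V by exact: open_nbhs_nbhs.
exists d => // y xy; apply: VU; apply: dV; split=> // i j.
by apply: cd_coord_ball => c; exact: (xy (i, j, c)).
Qed.

Lemma proj_coord_norm x : inner proj_coord x x = 1.
Proof. by rewrite -overlap_coord overlapxx. Qed.

Lemma overlap_le1 x y : overlap x y <= 1.
Proof. rewrite overlap_coord; exact: inner_le1 proj_coord_norm x y. Qed.

(** The coordinates generate the topology and are controlled by the overlap, so
    continuity of such a map is automatic. *)
Lemma overlap_preserving_continuous (g : X -> X) :
  (forall x y, overlap (g x) (g y) = overlap x y) -> continuous g.
Proof.
move=> gd x U /proj_coord_nbhs [d d0 dU].
have co : continuous (fun y : X => overlap x y).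
  have -> : (fun y : X => overlap x y) =
      (fun y => \sum_e proj_coord e x * proj_coord e y).
    by apply/funext => y; rewrite overlap_coord.
  apply: continuous_big => [|e _ y]; first exact: add_continuous.
  by apply: cvgMl_tmp; [exact: nbhs_filter|exact: proj_coord_continuous].
have : \forall y \near x, 1 - d ^+ 2 / 2 < overlap x y.
  apply: (cvgr_gt _ (co x)); rewrite overlapxx.
  by have := exprn_gt0 2 d0; lra.
apply: filterS => y xy; apply: dU => e.
have le : (proj_coord e (g x) - proj_coord e (g y)) ^+ 2 <= 2 * (1 - overlap x y).
  rewrite -gd overlap_coord -(dist_inner proj_coord_norm) (bigD1 e)//= lerDl.
  by apply: sumr_ge0 => i _; exact: sqr_ge0.
move: le; set a := _ - _ => le; rewrite ltr_norml; apply/andP.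
by split; move: xy d0 le; nra.
Qed.

Lemma measurable_proj_coord e : measurable_fun [set: T] (proj_coord e : T -> R).
Proof.
apply: (measurability _ (RGenOpens.measurableE R)).
move=> _ [_ [a [b ->] <-]]; rewrite setTI; apply: sub_sigma_algebra.
have /continuousP := @proj_coord_continuous e.
by apply; exact: interval_open.
Qed.

Lemma measurable_overlap_preserving (g : X -> X) :
  (forall x y, overlap (g x) (g y) = overlap x y) ->
  measurable_fun [set: T] (g : T -> T).
Proof.
move=> gd. apply: (@measurability _ _ T T setT g (@open X) erefl).
move=> _ [A oA <-]; rewrite setTI; apply: sub_sigma_algebra.
by have /continuousP := overlap_preserving_continuous gd; apply.
Qed.

Section Invariant.
Variable sigma : probability T R.
Hypothesis hsigma : isometry_invariant sigma.
Hypothesis hO : F = Octonions -> n = 2%N.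

Lemma isometry_integral (g : X -> X) (f : T -> \bar R) : Defs.isometry g ->
  (forall x y, overlap (g x) (g y) = overlap x y) ->
  measurable_fun setT f -> (forall x, (0 <= f x)%E) ->
  (\int[sigma]_x f (g x) = \int[sigma]_x f x)%E.
Proof.
move=> gi gd mf f0; have mg := measurable_overlap_preserving gd.
have := @ge0_integral_pushforward _ _ T T R g mg sigma setT f measurableT mf.
rewrite preimage_setT => <-; last by move=> x _; exact: f0.
apply: eq_measure_integral => A mA _; rewrite /pushforward /=.
exact: hsigma.
Qed.

(** An isometry moves any point to a base point, and the invariance of [sigma]
    removes it from the integration variable. *)
Lemma potential_const (f : R -> \bar R) :
  (forall x, measurable_fun [set: T] (fun y : T => f (overlap x y))) ->
  (forall r, (0 <= f r)%E) ->
  forall x x' : X, (\int[sigma]_y f (overlap x y) = \int[sigma]_y f (overlap x' y))%E.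
Proof.
move=> mf f0.
suff H x : (\int[sigma]_y f (overlap x y) =
    \int[sigma]_y f (overlap (point : X) y))%E.
  by move=> x x'; rewrite (H x) (H x').
have [g [gi gd gx]] := projspace_transitive hO x.
rewrite -gx -[RHS](isometry_integral gi gd)//; last exact: mf.
by apply: eq_integral => y _; rewrite /overlap gd.
Qed.

End Invariant.

Section Points.
Hypothesis hO : F = Octonions -> n = 2%N.

(** Move [x] to the first coordinate point: the overlap becomes a diagonal
    entry of a projection. *)
Lemma overlap_ge0 x y : 0 <= overlap x y.
Proof.
have [g [_ gd gx]] := projspace_transitive hO x.
rewrite /overlap -gd gx hdotE.
rewrite (bigD1 0)//= [X in _ + X]big1 ?addr0; last first.
  move=> i /negbTE i0; apply: big1 => j _; rewrite mxE i0 /=.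
  by rewrite /cd_dot (cd_mul0 _ _).1 cd_re0.
rewrite (bigD1 0)//= big1 ?addr0; last first.
  by move=> j /negbTE j0; rewrite mxE j0 andbF /cd_dot (cd_mul0 _ _).1 cd_re0.
by rewrite mxE /= cd_dotC cd_dot1; apply: diag_ge0; exact: set_valP.
Qed.

Lemma real_point (v : 'I_n.+1 -> R) : \sum_i v i ^+ 2 = 1 ->
  exists x : X, set_val x = \matrix_(i, j) ((v i * v j) *: cd_one R (cd_level F)).
Proof.
move=> v1; set P := \matrix_(i, j) _.
suff pP : projspace R F n P by exists (exist _ P (mem_set pP)).
apply/projspaceP; split.
- by move=> i j; rewrite !mxE cd_conj_real mulrC.
- move=> i j k; rewrite !mxE cd_reZ cd_re1 cd_mulZl cd_mulZr cd_mul1l !scalerA.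
  by congr (_ *: _); ring.
- rewrite /mxtrace; under eq_bigr do rewrite mxE -expr2.
  by rewrite -scaler_suml v1 scale1r.
Qed.

Lemma real_overlap (v w : 'I_n.+1 -> R) (x y : X) :
  set_val x = \matrix_(i, j) ((v i * v j) *: cd_one R (cd_level F)) ->
  set_val y = \matrix_(i, j) ((w i * w j) *: cd_one R (cd_level F)) ->
  overlap x y = (\sum_i v i * w i) ^+ 2.
Proof.
move=> ex ey; rewrite /overlap hdotE ex ey expr2 mulr_suml.
apply: eq_bigr => i _; rewrite mulr_sumr; apply: eq_bigr => j _.
by rewrite !mxE cd_dotZl cd_dotZr cd_norm1; ring.
Qed.

(** For the lines spanned by (1, a) and (1, b) the overlap is
    1 - (a - b)^2 / ((1 + a^2) (1 + b^2)); take the slopes 0, 1/m, ..., (m-1)/m. *)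
Lemma separated_points m : (0 < n)%N ->
  exists p : 'I_m -> X,
  forall i j, i != j -> overlap (p i) (p j) <= 1 - (4 * m%:R ^+ 2)^-1.
Proof.
move=> n0.
pose N (a : R) := Num.sqrt (1 + a ^+ 2).
pose v (a : R) (i : 'I_n.+1) :=
  if i == 0 then (N a)^-1 else if i == inord 1 then a / N a else 0.
have i1 : (inord 1 : 'I_n.+1) != 0.
  by rewrite -val_eqE /= inordK.
have N2 a : N a ^+ 2 = 1 + a ^+ 2 by rewrite sqr_sqrtr// addr_ge0 ?sqr_ge0.
have N0 a : N a != 0.
  rewrite sqrtr_eq0 -ltNge; have := sqr_ge0 a; lra.
have vw a b : \sum_i v a i * v b i = (1 + a * b) / (N a * N b).
  rewrite (bigD1 0)//= (bigD1 (inord 1))//= big1 ?addr0; last first.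
    by move=> i /andP[/negbTE i0 /negbTE i1']; rewrite /v i0 i1' mulr0.
  by rewrite /v eqxx (negbTE i1) eqxx; field; rewrite !N0.
have v1 a : \sum_i v a i ^+ 2 = 1.
  under eq_bigr do rewrite expr2.
  rewrite vw -!expr2 N2 divff// -N2 expf_eq0 /=; exact: N0.
have /boolp.choice [q qE] := fun a => real_point (v1 a).
exists (fun i : 'I_m => q (i%:R / m%:R)) => i j ij.
rewrite (real_overlap (qE _) (qE _)) vw.
set a := i%:R / m%:R; set b := j%:R / m%:R.
have m0 : (0 : R) < m%:R by rewrite ltr0n (leq_trans _ (ltn_ord i)).
have a01 : 0 <= a <= 1.
  by rewrite divr_ge0//= ler_pdivrMr// mul1r ler_nat ltnW.
have b01 : 0 <= b <= 1.
  by rewrite divr_ge0//= ler_pdivrMr// mul1r ler_nat ltnW.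
have ab : (m%:R ^+ 2)^-1 <= (a - b) ^+ 2.
  rewrite /a /b -mulrBl expr_div_n ler_pdivlMr ?exprn_gt0//.
  rewrite mulVf ?gt_eqF ?exprn_gt0// -real_normK ?num_real// exprn_ege1//.
  rewrite distrC.
  move: ij; rewrite neq_ltn => /orP[ij|ij].
    by rewrite -natrB ?normr_nat ?ler1n ?subn_gt0// ltnW.
  by rewrite distrC -natrB ?normr_nat ?ler1n ?subn_gt0// ltnW.
have -> : ((1 + a * b) / (N a * N b)) ^+ 2 =
   1 - (a - b) ^+ 2 / ((1 + a ^+ 2) * (1 + b ^+ 2)).
  rewrite -!N2; have := N2 a; have := N2 b; move: (N0 a) (N0 b).
  set x := N a; set y := N b => x0 y0 ex ey.
  have : (1 + a * b) ^+ 2 = x ^+ 2 * y ^+ 2 - (a - b) ^+ 2 by rewrite ex ey; ring.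
  by move=> e; rewrite expr_div_n e; field; rewrite x0 y0.
have AB4 : (4 : R)^-1 <= ((1 + a ^+ 2) * (1 + b ^+ 2))^-1.
  rewrite lef_pV2 ?posrE ?mulr_gt0 ?ltr_pwDl ?sqr_ge0//.
  have [/andP[a0 a1] /andP[b0 b1]] := (a01, b01).
  have a2 : a ^+ 2 <= 1 by rewrite expr_le1.
  have b2 : b ^+ 2 <= 1 by rewrite expr_le1.
  apply: (@le_trans _ _ (2 * 2)); last by rewrite -natrM.
  by apply: ler_pM; rewrite ?addr_ge0 ?sqr_ge0//; lra.
rewrite lerD2l lerN2 invfM [4^-1 * _]mulrC; apply: ler_pM => //.
Qed.

End Points.
End Coordinates.

(** * The logarithmic series *)

Section LogSeries.
Variable R : realType.
Implicit Types (t x : R) (M : nat).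

Definition log_sum M t : R := \sum_(k < M) t ^+ k.+1 / k.+1%:R.

Lemma log_sumS M t : log_sum M.+1 t = log_sum M t + t ^+ M.+1 / M.+1%:R.
Proof. by rewrite /log_sum big_ord_recr. Qed.

Lemma is_derive_log_sum M t : is_derive t 1 (log_sum M) (\sum_(k < M) t ^+ k).
Proof.
elim: M => [|M IH].
  rewrite big_ord0 (_ : log_sum 0 = cst 0); first exact: is_derive_cst.
  by apply/funext => x; rewrite /log_sum big_ord0.
rewrite big_ord_recr /= (_ : log_sum M.+1 =
  log_sum M + (M.+1%:R^-1 \*: (id ^+ M.+1)) :> (R -> R)); last first.
  by apply/funext => x; rewrite log_sumS mulrC !fctE.
apply: (is_derive_eq (is_deriveD IH (is_deriveZ _ (is_deriveX M.+1 (is_derive_id t 1))))).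
by rewrite /GRing.scale /= mulr1 mulrA mulVf ?mul1r ?pnatr_eq0.
Qed.

Lemma is_derive_log_remainder M t : t < 1 ->
  is_derive t 1 (fun x => - ln (1 - x) - log_sum M x) (t ^+ M / (1 - t)).
Proof.
move=> t1; have h : 0 < 1 - t by rewrite subr_gt0.
have D := is_deriveB (is_derive_cst (1 : R) t 1) (is_derive_id t 1).
have L : is_derive t 1 ((@ln R) \o (cst 1 - id)) ((1 - t)^-1 * (0 - 1)).
  by apply: is_derive1_comp; exact: is_derive1_ln.
apply: (is_derive_eq (is_deriveB (is_deriveN L) (is_derive_log_sum M t))).
rewrite sub0r mulrN1 opprK; apply: (mulIf (lt0r_neq0 h)).
rewrite mulrBl mulVf ?divfK ?lt0r_neq0//.
by have := subrX1 t M; set S := \sum_(_ < _) _; lra.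
Qed.

(** Mean value theorem: the remainder has derivative t^M / (1 - t). *)
Lemma log_remainder M t : 0 <= t < 1 ->
  0 <= - ln (1 - t) - log_sum M t <= t ^+ M / (1 - t).
Proof.
move=> /andP[t0 t1].
have [||c /[!in_itv]/= /andP[c0 ct]] := @MVT_segment R
  (fun x => - ln (1 - x) - log_sum M x) (fun x => x ^+ M / (1 - x)) 0 t t0.
- move=> x; rewrite in_itv /= => /andP[_ xt].
  by apply: is_derive_log_remainder; exact: lt_trans t1.
- apply: continuous_in_subspaceT => x; rewrite inE /= in_itv /= => /andP[_ xt].
  have D := is_derive_log_remainder M (le_lt_trans xt t1).
  apply/differentiable_continuous/derivable1_diffP; exact: ex_derive.
rewrite subr0 ln1 oppr0 [log_sum M 0]big1 => [|k _]; last first.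
  by rewrite expr0n mul0r.
rewrite !subr0 !addr0 => ->.
have c1 : 0 < 1 - c by rewrite subr_gt0 (le_lt_trans ct).
have t1' : 0 < 1 - t by rewrite subr_gt0.
rewrite mulr_ge0 ?divr_ge0 ?exprn_ge0 ?(ltW c1)//=.
rewrite -[leRHS]mulr1; apply: ler_pM => //.
- by rewrite divr_ge0 ?exprn_ge0 ?(ltW c1).
- apply: ler_pM; rewrite ?invr_ge0 ?exprn_ge0 ?(ltW c1)//.
    by rewrite lerXn2r ?nnegrE.
  by rewrite lef_pV2 ?posrE// lerD2l lerN2.
- exact: ltW.
Qed.

Lemma log_sum_cvg t : 0 <= t < 1 -> log_sum ^~ t @ \oo --> - ln (1 - t).
Proof.
move=> t01; have /andP[t0 t1] := t01.
have H : (fun M => - ln (1 - t) - t ^+ M * (1 - t)^-1) @ \oo --> - ln (1 - t).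
  rewrite -[X in _ --> X]subr0; apply: cvgB; first exact: cvg_cst.
  rewrite -[X in _ --> X](mul0r (1 - t)^-1); apply: cvgMr_tmp.
  by apply: cvg_expr; rewrite ger0_norm.
apply: (squeeze_cvgr _ H (cvg_cst (- ln (1 - t)))).
by apply: nearW => M; have := log_remainder M t01; lra.
Qed.

Lemma harmonic_le M : (0 < M)%N -> log_sum M (1 : R) <= 1 + ln M%:R.
Proof.
case: M => // M _; elim: M => [|M IH].
  by rewrite /log_sum big_ord_recl big_ord0 expr1n ln1 divr1 addr0.
rewrite log_sumS expr1n mul1r.
have M1 : (0 : R) < M.+1%:R by rewrite ltr0n.
have M2 : (0 : R) < M.+2%:R by rewrite ltr0n.
have := @le_ln1Dx R (- M.+2%:R^-1).
rewrite ltrN2 invf_lt1// ltr1n => /(_ isT).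
have -> : 1 - M.+2%:R^-1 = M.+1%:R / M.+2%:R :> R.
  by rewrite -[M.+1%:R](addrK 1) natr1 mulrBl divff ?gt_eqF// mul1r.
rewrite ln_div ?posrE//; move: IH; move: (ln _) (ln _) (_^-1) (log_sum _ _) => a b c d; lra.
Qed.

Lemma harmonic_ge M : ln M.+1%:R <= log_sum M (1 : R).
Proof.
elim: M => [|M IH]; first by rewrite /log_sum big_ord0 ln1.
rewrite log_sumS expr1n mul1r.
have M1 : (0 : R) < M.+1%:R by rewrite ltr0n.
have M2 : (0 : R) < M.+2%:R by rewrite ltr0n.
have i0 : -1 < (M.+1%:R : R)^-1 by rewrite (lt_trans (ltrN10 R)) ?invr_gt0.
have := le_ln1Dx i0.
have -> : 1 + M.+1%:R^-1 = M.+2%:R / M.+1%:R :> R.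
  by rewrite -[M.+2%:R]natr1 mulrDl divff ?gt_eqF// mul1r.
rewrite ln_div ?posrE//; move: IH; move: (ln _) (ln _) (_^-1) (log_sum _ _) => a b c d; lra.
Qed.

(** The kernel - log rho as a function of t, since 1 - t is the square of
    rho. *)
Definition log_kernel t : \bar R :=
  if t < 1 then (- ln (1 - t) / 2)%:E else +oo%E.

Lemma log_kernel_cvg t : 0 <= t <= 1 ->
  (log_sum M t / 2)%:E @[M --> \oo] --> log_kernel t.
Proof.
move=> /andP[t0]; rewrite /log_kernel le_eqVlt; case: ltrP => [t1 _|t1 /orP[|//]].
  apply: cvg_EFin; first exact: nearW.
  by apply: cvgMr_tmp; apply: log_sum_cvg; rewrite t0.
move=> /eqP ->; apply/cvgeyPge => B.
exists (Num.truncn (expR (2 * B))) => // M /= BM.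
rewrite lee_fin ler_pdivlMr// mulrC; apply: le_trans (harmonic_ge M).
rewrite -[leLHS]expRK ler_ln ?posrE ?expR_gt0//.
apply: (le_trans (ltW (truncnS_gt _))); rewrite ler_nat ltnS//.
Qed.

Lemma log_sum_nd t : 0 <= t -> {homo log_sum ^~ t : M N / (M <= N)%N >-> M <= N}.
Proof.
move=> t0; apply: homo_leq => [//|x y z|M]; first exact: le_trans.
by rewrite log_sumS lerDl divr_ge0// exprn_ge0.
Qed.

Lemma log_sum_ge0 M t : 0 <= t -> 0 <= log_sum M t.
Proof. by move=> t0; apply: sumr_ge0 => k _; rewrite divr_ge0// exprn_ge0. Qed.

Lemma log_sum_le_kernel M t : 0 <= t <= 1 -> ((log_sum M t / 2)%:E <= log_kernel t)%E.
Proof.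
move=> /andP[t0 _]; rewrite /log_kernel; case: ifPn => [t1|_]; last exact: leey.
have := @log_remainder M t; rewrite t0 t1 => /(_ isT) /andP[H _].
by rewrite lee_fin ler_pM2r// -subr_ge0.
Qed.

Lemma log_kernel_ge0 t : 0 <= t -> (0 <= log_kernel t)%E.
Proof.
move=> t0; rewrite /log_kernel; case: ifPn => [t1|_]; last exact: leey.
by rewrite lee_fin divr_ge0// oppr_ge0 ln_le0// gerBl.
Qed.

Lemma log_kernel_ge (b t : R) : 0 < b -> 1 - t <= b -> ((- ln b / 2)%:E <= log_kernel t)%E.
Proof.
move=> b0 tb; rewrite /log_kernel; case: ifPn => [t1|_]; last exact: leey.
by rewrite lee_fin ler_pM2r// lerN2 ler_ln ?posrE// subr_gt0.
Qed.

End LogSeries.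

(** * Integrals of bounded functions *)

Section BoundedIntegrals.
Context {d : measure_display} {T : measurableType d} {R : realType}.
Variable sigma : probability T R.
Implicit Types f g : T -> R.

Definition bdd_measurable f :=
  measurable_fun [set: T] f /\ exists b : R, forall x, `|f x| <= b.

Lemma bdd_integrable f : bdd_measurable f -> sigma.-integrable setT (EFin \o f).
Proof.
move=> [mf [b fb]]; apply: measurable_bounded_integrable => //.
  by apply: (le_lt_trans (probability_le1 sigma measurableT)); exact: ltry.
exists b; split; first exact: num_real.
by move=> M bM x _ /=; apply: le_trans (fb x) (ltW bM).
Qed.

Lemma bdd_sum (I : Type) (s : seq I) (F : I -> T -> R) :
  (forall i, bdd_measurable (F i)) -> bdd_measurable (fun x => \sum_(i <- s) F i x).
Proof.
move=> bF; split; first by apply: measurable_sum => i; exact: (bF i).1.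
have /boolp.choice [b Fb] := fun i => (bF i).2.
exists (\sum_(i <- s) b i) => x; apply: (le_trans (ler_norm_sum _ _ _)).
by apply: ler_sum => i _; exact: Fb.
Qed.

Lemma bddM f g : bdd_measurable f -> bdd_measurable g ->
  bdd_measurable (fun x => f x * g x).
Proof.
move=> [mf [b fb]] [mg [c gc]]; split; first exact: measurable_funM.
by exists (b * c) => x; rewrite normrM ler_pM.
Qed.

Lemma bdd_cst r : bdd_measurable (fun=> r).
Proof. by split; [exact: measurable_cst|exists `|r|]. Qed.

Lemma bdd_prod (I : Type) (s : seq I) (F : I -> T -> R) :
  (forall i, bdd_measurable (F i)) -> bdd_measurable (fun x => \prod_(i <- s) F i x).
Proof.
move=> bF; elim: s => [|i s IH].
  by under eq_fun do rewrite big_nil; exact: bdd_cst.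
by under eq_fun do rewrite big_cons; exact: bddM.
Qed.

Lemma Rintegral_sum (I : Type) (s : seq I) (F : I -> T -> R) :
  (forall i, bdd_measurable (F i)) ->
  (\int[sigma]_x (\sum_(i <- s) F i x) = \sum_(i <- s) \int[sigma]_x F i x)%R.
Proof.
move=> bF; elim: s => [|i s IH].
  rewrite big_nil; under eq_Rintegral do rewrite big_nil.
  by rewrite Rintegral_cst// mul0r.
rewrite big_cons -IH -RintegralD//; last 2 first.
- exact: bdd_integrable.
- by apply: bdd_integrable; exact: bdd_sum.
by apply: eq_Rintegral => x _; rewrite big_cons.
Qed.

Lemma Rintegral_cst1 r : (\int[sigma]_x r = r)%R.
Proof.
transitivity (r * fine (sigma setT)); first exact: Rintegral_cst.
by rewrite probability_setT mulr1.
Qed.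

Lemma EFin_Rintegral f : bdd_measurable f ->
  (\int[sigma]_x (f x)%:E)%E = (\int[sigma]_x f x)%R%:E.
Proof. by move=> bf; rewrite fineK//; apply: integrable_fin_num => //; exact: bdd_integrable. Qed.

Lemma le_bdd_Rintegral f g : bdd_measurable f -> bdd_measurable g ->
  (forall x, f x <= g x) -> (\int[sigma]_x f x <= \int[sigma]_x g x)%R.
Proof. by move=> bf bg fg; apply: le_Rintegral => //; exact: bdd_integrable. Qed.

End BoundedIntegrals.

(** * The lower bound *)

Section LogEnergy.
Context {d : measure_display} {T : measurableType d} {R : realType}.
Variable sigma : probability T R.
Variables (I : finType) (phi : I -> T -> R).
Hypothesis mphi : forall e, measurable_fun [set: T] (phi e).

Local Notation t := (inner phi).

Hypothesis t01 : forall x y, 0 <= t x y <= 1.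
Hypothesis txx : forall x, t x x = 1.

Variable c : nat -> R.
Hypothesis hc : forall k x, (\int[sigma]_y (t x y ^+ k) = c k)%R.

Lemma bdd_phi e : bdd_measurable (phi e).
Proof. by split=> //; exists 1 => x; rewrite ler_norml coord_range. Qed.

Lemma bdd_inner x : bdd_measurable (t x).
Proof. by apply: bdd_sum => e; apply: bddM; [exact: bdd_cst|exact: bdd_phi]. Qed.

Lemma bdd_innerX x k : bdd_measurable (fun y => t x y ^+ k).
Proof.
have -> : (fun y => t x y ^+ k) = (fun y => \prod_(i < k) t x y).
  by apply/funext => y; rewrite prodr_const card_ord.
by apply: bdd_prod => i; exact: bdd_inner.
Qed.

(** The coordinates, indexed by words of length [k], of the [k]-th tensor power
    of the vector x; they exhibit the [k]-th power of [inner] as an inner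
    product ([innerX]). *)
Definition tensor k (f : {ffun 'I_k -> I}) (x : T) : R := \prod_l phi (f l) x.
Definition tensor_mean k (f : {ffun 'I_k -> I}) : R := (\int[sigma]_x tensor f x)%R.

Lemma bdd_tensor k (f : {ffun 'I_k -> I}) : bdd_measurable (tensor f).
Proof. by apply: bdd_prod => l; exact: bdd_phi. Qed.

Lemma innerX k x y : t x y ^+ k = \sum_(f : {ffun 'I_k -> I}) tensor f x * tensor f y.
Proof.
rewrite -[k in LHS]card_ord -prodr_const bigA_distr_bigA.
by apply: eq_bigr => f _; rewrite big_split.
Qed.

Lemma moment_tensor k x : c k = \sum_f @tensor k f x * tensor_mean f.
Proof.
rewrite -(hc k x); under eq_Rintegral do rewrite innerX.
rewrite Rintegral_sum; last first.
  by move=> f; apply: bddM; [exact: bdd_cst|exact: bdd_tensor].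
apply: eq_bigr => f _; rewrite RintegralZl//.
exact: bdd_integrable (bdd_tensor f).
Qed.

Lemma moment_sqr k : c k = \sum_(f : {ffun 'I_k -> I}) tensor_mean f ^+ 2.
Proof.
rewrite -(Rintegral_cst1 sigma (c k)).
under eq_Rintegral => x _ do rewrite (moment_tensor k x).
rewrite Rintegral_sum; last first.
  by move=> f; apply: bddM; [exact: bdd_tensor|exact: bdd_cst].
apply: eq_bigr => f _; rewrite RintegralZr ?expr2//.
exact: bdd_integrable (bdd_tensor f).
Qed.

(** If s f is the sum over the [m] points of the tensor coordinate f, the
    difference of the two sides is the sum over f of (s f - m * mean f)^2. *)
Lemma moment_le m (w : 'I_m -> T) k :
  m%:R ^+ 2 * c k <= \sum_i \sum_j t (w i) (w j) ^+ k.
Proof.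
pose s (f : {ffun 'I_k -> I}) := \sum_i tensor f (w i).
have -> : \sum_i \sum_j t (w i) (w j) ^+ k = \sum_f s f ^+ 2.
  under eq_bigr => i _ do under eq_bigr => j _ do rewrite innerX.
  under eq_bigr do rewrite exchange_big.
  rewrite exchange_big; apply: eq_bigr => f _.
  by rewrite expr2 /s mulr_suml; apply: eq_bigr => i _; rewrite mulr_sumr.
have cs : m%:R * c k = \sum_f s f * tensor_mean f.
  transitivity (\sum_(i < m) c k); first by rewrite sumr_const card_ord mulr_natl.
  under eq_bigr => i _ do rewrite (moment_tensor k (w i)).
  by rewrite exchange_big; apply: eq_bigr => f _; rewrite /s mulr_suml.
have : 0 <= \sum_f (s f - m%:R * tensor_mean f) ^+ 2.
  by apply: sumr_ge0 => f _; exact: sqr_ge0.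
have -> : \sum_f (s f - m%:R * tensor_mean f) ^+ 2 =
   \sum_f s f ^+ 2 - 2 * m%:R * (m%:R * c k) + m%:R ^+ 2 * c k.
  rewrite cs (moment_sqr k) !mulr_sumr -sumrB -big_split /=.
  by apply: eq_bigr => f _; ring.
by move=> h; rewrite -subr_ge0; apply: (le_trans h); rewrite le_eqVlt; apply/orP;
  left; apply/eqP; ring.
Qed.

Lemma moment_ge0 k : 0 <= c k.
Proof. by rewrite moment_sqr; apply: sumr_ge0 => f _; exact: sqr_ge0. Qed.

Lemma moment_nincr k l : (k <= l)%N -> c l <= c k.
Proof.
move=> kl; rewrite -(hc k point) -(hc l point).
apply: le_bdd_Rintegral => [| |y]; try exact: bdd_innerX.
by have /andP[? ?] := t01 point y; rewrite ler_wiXn2l.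
Qed.

Hypothesis separated : forall m, exists p : 'I_m -> T,
  forall i j, i != j -> t (p i) (p j) <= 1 - (4 * m%:R ^+ 2)^-1.

(** Bernoulli's inequality for (1 - e)^-k. *)
Lemma bernoulli_inv (e : R) k : 0 <= e <= 1 -> (1 - e) ^+ k * (1 + k%:R * e) <= 1.
Proof.
move=> /andP[e0 e1]; elim: k => [|k IH]; first by rewrite expr0 mul0r addr0 mulr1.
apply: le_trans IH; rewrite exprSr -mulrA; apply: ler_wpM2l.
  by rewrite exprn_ge0// subr_ge0.
have k0 : (0 : R) <= k%:R by [].
by rewrite -natr1; nra.
Qed.

(** Apply [moment_le] to n separated points: the diagonal contributes n, and an
    off-diagonal term is at most (1 - 1/(4 n^2))^(n^3) <= 4/n.  The power n^3
    makes the exponent beat the separation n^2 by a factor n. *)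
Lemma moment_cube n : (0 < n)%N -> c (n ^ 3)%N <= 5 / n%:R.
Proof.
move=> n0; have [p hp] := separated n.
have n0' : (0 : R) < n%:R by rewrite ltr0n.
have n1 : (1 : R) <= n%:R by rewrite ler1n.
set e : R := (4 * n%:R ^+ 2)^-1 in hp.
have e01 : 0 <= e <= 1.
  rewrite invr_ge0 mulr_ge0 ?sqr_ge0//= invf_le1 ?mulr_gt0 ?exprn_gt0//; nra.
have e1 : (1 - e) ^+ (n ^ 3)%N <= 4 / n%:R.
  have := bernoulli_inv (n ^ 3)%N e01.
  have -> : 1 + (n ^ 3)%N%:R * e = (4 + n%:R) / 4.
    by rewrite /e natrX; field; rewrite gt_eqF.
  rewrite mulrA ler_pdivrMr// mul1r => h; rewrite ler_pdivlMr//.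
  apply: le_trans h; apply: ler_wpM2l; last by lra.
  by rewrite exprn_ge0// subr_ge0; case/andP: e01.
have : n%:R ^+ 2 * c (n ^ 3)%N <= n%:R + n%:R ^+ 2 * (4 / n%:R).
  apply: (le_trans (moment_le p _)).
  have -> : n%:R + n%:R ^+ 2 * (4 / n%:R) =
      \sum_(i < n) \sum_(j < n) ((i == j)%:R + 4 / n%:R) :> R.
    under eq_bigr => i _.
      rewrite big_split /= sumr_const card_ord -[_ *+ n]mulr_natl.
      rewrite (bigD1 i)//= eqxx big1 ?addr0; last by move=> j /negbTE; rewrite eq_sym => ->.
      over.
    by rewrite sumr_const card_ord -[RHS]mulr_natl mulr1n; ring.
  apply: ler_sum => i _; apply: ler_sum => j _.
  have /andP[t0 t1] := t01 (p i) (p j).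
  have [->|ij] := eqVneq i j.
    by rewrite txx expr1n lerDl divr_ge0.
  rewrite add0r; apply: le_trans e1; rewrite lerXn2r ?nnegrE ?hp//.
  by rewrite subr_ge0; case/andP: e01.
have -> : n%:R + n%:R ^+ 2 * (4 / n%:R) = n%:R ^+ 2 * (5 / n%:R) :> R.
  by field; rewrite gt_eqF.
by rewrite ler_pM2l// exprn_gt0.
Qed.

Definition moment_sum M : R := \sum_(k < M) c k.+1 / k.+1%:R.

Lemma moment_sum_nd : {homo moment_sum : M N / (M <= N)%N >-> M <= N}.
Proof.
apply: homo_leq => [//|x y z|M]; first exact: le_trans.
by rewrite /moment_sum big_ord_recr /= lerDl divr_ge0// moment_ge0.
Qed.

(** On the block n^3 <= k < (n+1)^3, of length at most 7 n^2, each term is at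
    most (5/n) / n^3.  The total 35/n^2 is at most 70/n - 70/(n+1), so the sum
    corrected by 70/n does not increase. *)
Lemma moment_sum_block n : (0 < n)%N ->
  moment_sum (n.+1 ^ 3)%N + 70 / n.+1%:R <= moment_sum (n ^ 3)%N + 70 / n%:R.
Proof.
move=> n0; have n0' : (0 : R) < n%:R by rewrite ltr0n.
have n1 : (1 : R) <= n%:R by rewrite ler1n.
have [r rE] : exists r, (n.+1 ^ 3 = n ^ 3 + r)%N.
  by exists (n.+1 ^ 3 - n ^ 3)%N; rewrite subnKC// leq_exp2r.
have rR : (r%:R : R) = 3 * n%:R ^+ 2 + 3 * n%:R + 1.
  have := congr1 (fun m => m%:R : R) rE; rewrite natrD !natrX -natr1.
  by move=> h; rewrite -[LHS](addKr (n%:R ^+ 3)) -h; ring.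
have : moment_sum (n.+1 ^ 3)%N <= moment_sum (n ^ 3)%N + 35 / n%:R ^+ 2.
  rewrite rE /moment_sum big_split_ord /= lerD2l.
  apply: (@le_trans _ _ (\sum_(i < r) (5 / n%:R / n%:R ^+ 3))).
    apply: ler_sum => i _; apply: ler_pM.
    - exact: moment_ge0.
    - by rewrite invr_ge0.
    - apply: le_trans (moment_cube n0); apply: moment_nincr.
      by rewrite -addnS leq_addr.
    - rewrite -natrX lef_pV2 ?posrE ?ltr0n ?expn_gt0 ?n0//.
      by rewrite ler_nat -addnS leq_addr.
  rewrite sumr_const card_ord -[_ *+ r]mulr_natl rR.
  rewrite -(@ler_pM2r _ (n%:R ^+ 4)) ?exprn_gt0//.
  have -> : (3 * n%:R ^+ 2 + 3 * n%:R + 1) * (5 / n%:R / n%:R ^+ 3) * n%:R ^+ 4 =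
     5 * (3 * n%:R ^+ 2 + 3 * n%:R + 1) :> R by field; rewrite gt_eqF.
  have -> : 35 / n%:R ^+ 2 * n%:R ^+ 4 = 35 * n%:R ^+ 2 :> R by field; rewrite gt_eqF.
  nra.
have : 35 / n%:R ^+ 2 + 70 / n.+1%:R <= 70 / n%:R :> R.
  have m0 : (0 : R) < n.+1%:R by rewrite ltr0n.
  rewrite -(@ler_pM2r _ (n%:R ^+ 2 * n.+1%:R)) ?mulr_gt0 ?exprn_gt0//.
  have -> : (35 / n%:R ^+ 2 + 70 / n.+1%:R) * (n%:R ^+ 2 * n.+1%:R) =
    35 * n.+1%:R + 70 * n%:R ^+ 2 :> R by field; rewrite !gt_eqF.
  have -> : 70 / n%:R * (n%:R ^+ 2 * n.+1%:R) = 70 * n%:R * n.+1%:R :> R.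
    by field; rewrite !gt_eqF.
  rewrite -natr1; nra.
move: (moment_sum _) (moment_sum _) (70 / n%:R) (70 / n.+1%:R) (35 / _) => a b c' d' e.
lra.
Qed.

Lemma moment_sum_tail M n : (0 < n)%N ->
  moment_sum M <= moment_sum (n ^ 3)%N + 70 / n%:R.
Proof.
move=> n0; have H j : moment_sum ((n + j) ^ 3)%N + 70 / (n + j)%:R <=
    moment_sum (n ^ 3)%N + 70 / n%:R.
  elim: j => [|j IH]; first by rewrite addn0.
  by apply: le_trans IH; rewrite addnS moment_sum_block// addn_gt0 n0.
apply: le_trans (H M); apply: (@le_trans _ _ (moment_sum ((n + M) ^ 3)%N)).
  apply: moment_sum_nd; apply: (leq_trans (leq_addl n M)).
  by rewrite -{1}[(n + M)%N]expn1 leq_pexp2l// addn_gt0 n0.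
by rewrite lerDl divr_ge0.
Qed.

Local Notation G := (fun x y : T => log_kernel (t x y)).

Lemma measurable_inner2 : measurable_fun setT (fun z : T * T => t z.1 z.2).
Proof.
apply: measurable_sum => e; apply: measurable_funM.
  exact: measurableT_comp (mphi e) measurable_fst.
exact: measurableT_comp (mphi e) measurable_snd.
Qed.

Lemma measurable_log_kernel2 : measurable_fun setT (fun z : T * T => G z.1 z.2).
Proof.
apply: (emeasurable_fun_cvg (fun M (z : T * T) => (log_sum M (t z.1 z.2) / 2)%:E)).
  move=> M; apply/measurable_EFinP; apply: measurable_funM => //.
  apply: measurable_sum => k; apply: measurable_funM => //.
  by apply: measurable_funX; exact: measurable_inner2.
by move=> z _; exact: log_kernel_cvg.
Qed.

Lemma bdd_log_sum M x : bdd_measurable (fun y => log_sum M (t x y) / 2).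
Proof.
apply: bddM; last exact: bdd_cst.
by apply: bdd_sum => k; apply: bddM; [exact: bdd_innerX|exact: bdd_cst].
Qed.

Lemma integral_log_sum M x : (\int[sigma]_y (log_sum M (t x y) / 2) = moment_sum M / 2)%R.
Proof.
rewrite RintegralZr//; last first.
  by apply: bdd_integrable; apply: bdd_sum => k; apply: bddM;
    [exact: bdd_innerX|exact: bdd_cst].
rewrite Rintegral_sum; last first.
  by move=> k; apply: bddM; [exact: bdd_innerX|exact: bdd_cst].
congr (_ / _); apply: eq_bigr => k _.
by rewrite RintegralZr ?hc//; exact: bdd_integrable (bdd_innerX _ _).
Qed.

(** Monotone convergence, with [moment_sum_tail] as the error bound. *)
Lemma log_potential : exists2 V : R,
  forall x, (\int[sigma]_y G x y)%E = V%:E &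
  forall n, (0 < n)%N ->
    moment_sum (n ^ 3)%N / 2 <= V <= moment_sum (n ^ 3)%N / 2 + 35 / n%:R.
Proof.
pose u M : \bar R := (moment_sum M / 2)%:E.
have und : nondecreasing_seq u.
  by move=> M N MN; rewrite lee_fin ler_pM2r// moment_sum_nd.
have potE x : (\int[sigma]_y G x y)%E = limn u.
  have -> : u = (fun M => \int[sigma]_y (log_sum M (t x y) / 2)%:E)%E.
    apply/funext => M; rewrite EFin_Rintegral ?integral_log_sum//.
    exact: bdd_log_sum.
  rewrite -monotone_convergence//.
  - apply: eq_integral => y _; apply/esym/cvg_lim => //.
    exact: log_kernel_cvg.
  - by move=> M; apply/measurable_EFinP; exact: (bdd_log_sum M x).1.
  - move=> M y _; rewrite lee_fin divr_ge0// log_sum_ge0//.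
    by case/andP: (t01 x y).
  - move=> y _ M N MN; rewrite lee_fin ler_pM2r//; apply: log_sum_nd => //.
    by case/andP: (t01 x y).
have ucvg := ereal_nondecreasing_is_cvgn und.
have lim_ub n : (0 < n)%N -> (limn u <= (moment_sum (n ^ 3)%N / 2 + 35 / n%:R)%:E)%E.
  move=> n0; apply: lime_le => //; apply: nearW => M; rewrite lee_fin.
  have := moment_sum_tail M n0.
  have -> : 70 / n%:R = 2 * (35 / n%:R) :> R by field; rewrite pnatr_eq0 -lt0n.
  by move: (moment_sum M) (moment_sum _) (35 / _) => a b e; lra.
have lim_lb n : ((moment_sum (n ^ 3)%N / 2)%:E <= limn u)%E.
  apply: lime_ge => //; near=> M; apply: und.
  by near: M; exists (n ^ 3)%N.
have fin : limn u \is a fin_num.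
  rewrite fin_numE; apply/andP; split.
    by apply/eqP => h; have := lim_lb 1%N; rewrite h.
  by apply/eqP => h; have := lim_ub 1%N isT; rewrite h.
exists (fine (limn u)) => [x|n n0]; first by rewrite potE fineK.
by rewrite -!lee_fin fineK// lim_lb lim_ub.
Unshelve. all: by end_near. Qed.

Lemma sum_off_diag (N : nat) (f : 'I_N -> 'I_N -> R) :
  \sum_i \sum_(j | j != i) f i j = \sum_i \sum_j f i j - \sum_i f i i.
Proof.
rewrite -sumrB; apply: eq_bigr => i _.
by rewrite [in RHS](bigD1 i)//= [X in X - _]addrC addrK.
Qed.

Lemma log_sum_energy_ge N (w : 'I_N -> T) M :
  N%:R ^+ 2 * moment_sum M <= \sum_i \sum_j log_sum M (t (w i) (w j)).
Proof.
have -> : \sum_i \sum_j log_sum M (t (w i) (w j)) =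
    \sum_(k < M) (\sum_i \sum_j t (w i) (w j) ^+ k.+1) / k.+1%:R.
  under [RHS]eq_bigr => k _ do rewrite mulr_suml.
  rewrite [RHS]exchange_big; apply: eq_bigr => i _.
  under [RHS]eq_bigr => k _ do rewrite mulr_suml.
  by rewrite [RHS]exchange_big.
rewrite mulr_sumr; apply: ler_sum => k _.
by rewrite mulrA ler_pM2r ?invr_gt0// moment_le.
Qed.

(** Truncation of the series at M = N^3: the error 35/N on the constant V costs
    35 N, and the missing diagonal costs N/2 harmonic sums of length N^3. *)
Lemma energy_ge V N (w : 'I_N -> T) : (0 < N)%N ->
  (forall n, (0 < n)%N ->
    moment_sum (n ^ 3)%N / 2 <= V <= moment_sum (n ^ 3)%N / 2 + 35 / n%:R) ->
  ((V * N%:R ^+ 2 - N%:R * (36 + 3 * ln N%:R))%:E <= energy G w)%E.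
Proof.
move=> N0 hV; pose M := (N ^ 3)%N.
have N0' : (0 : R) < N%:R by rewrite ltr0n.
have l0 : 0 <= ln (N%:R : R) by rewrite ln_ge0// ler1n.
apply: (@le_trans _ _ (\sum_i \sum_(j | j != i) (log_sum M (t (w i) (w j)) / 2))%:E).
  rewrite lee_fin (sum_off_diag (fun i j => log_sum M (t (w i) (w j)) / 2)).
  under eq_bigr do rewrite -mulr_suml.
  rewrite -mulr_suml.
  have -> : \sum_i log_sum M (t (w i) (w i)) / 2 = N%:R * (log_sum M 1 / 2).
    under eq_bigr do rewrite txx.
    by rewrite sumr_const card_ord mulr_natl.
  have := @harmonic_le R M; rewrite expn_gt0 N0 => /(_ isT).
  rewrite natrX lnXn// -[_ *+ 3]mulr_natl => hM.
  have hE := log_sum_energy_ge w M.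
  have /andP[_ V2] := hV N N0.
  have V3 : V * N%:R ^+ 2 <= N%:R ^+ 2 * moment_sum M / 2 + 35 * N%:R.
    have -> : N%:R ^+ 2 * moment_sum M / 2 + 35 * N%:R =
        (moment_sum M / 2 + 35 / N%:R) * N%:R ^+ 2 by field; rewrite gt_eqF.
    by rewrite ler_pM2r ?exprn_gt0.
  have H4 : N%:R * (log_sum M 1 / 2) <= N%:R * ((1 + 3 * ln N%:R) / 2) :> R.
    by rewrite ler_pM2l// ler_pM2r.
  have H5 : 0 <= N%:R * ln (N%:R : R) by rewrite mulr_ge0// ltW.
  by nra.
rewrite -sumEFin; apply: lee_sum => i _; rewrite -sumEFin.
by apply: lee_sum => j _; exact: log_sum_le_kernel.
Qed.

Hypothesis frame : exists m, exists b : 'I_m -> T, forall y, \sum_i t (b i) y = 1.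

(** Integrating the frame identity gives m * c 1 = 1. *)
Lemma moment1_gt0 : 0 < c 1%N.
Proof.
have [m [b hb]] := frame.
have E1 : (\int[sigma]_y (\sum_i t (b i) y) = 1)%R.
  by rewrite -[RHS](Rintegral_cst1 sigma 1); apply: eq_Rintegral => y _; exact: hb.
have : m%:R * c 1%N = 1.
  rewrite -[RHS]E1 Rintegral_sum; last by move=> i; exact: bdd_inner.
  under eq_bigr => i _.
    have -> : (\int[sigma]_y t (b i) y = c 1%N)%R.
      by rewrite -(hc 1 (b i)); apply: eq_Rintegral => y _; rewrite expr1.
    over.
  by rewrite sumr_const card_ord mulr_natl.
move=> h; rewrite lt_neqAle moment_ge0 andbT eq_sym; apply/eqP => c0.
by move: h; rewrite c0 mulr0 => /eqP; rewrite eq_sym oner_eq0.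
Qed.

End LogEnergy.

(** * Independent random points *)

Section Averaging.
Context {d : measure_display} {T : measurableType d} {R : realType}.
Variable sigma : probability T R.
Variable G : T -> T -> \bar R.
Hypothesis G0 : forall x y, (0 <= G x y)%E.
Hypothesis mG : measurable_fun setT (fun z : T * T => G z.1 z.2).
Local Open Scope ereal_scope.

Variables (N : nat) (h : 'I_N -> T -> R).
Hypothesis mh : forall i, measurable_fun [set: T] (h i).
Hypothesis h0 : forall i x, (0 <= h i x)%R.
Hypothesis h1 : forall i, \int[sigma]_x (h i x)%:E = 1.

(** Potential of the measure of density [h j]. *)
Definition wpot j x : \bar R := \int[sigma]_y ((h j y)%:E * G x y).
Definition wenergy i j : \bar R := \int[sigma]_x ((h i x)%:E * wpot j x).

Lemma measurable_hE i : measurable_fun [set: T] (fun x => (h i x)%:E).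
Proof. exact/measurable_EFinP. Qed.

Lemma wpot_ge0 j x : 0 <= wpot j x.
Proof. by apply: integral_ge0 => y _; rewrite mule_ge0// lee_fin. Qed.

Lemma wenergy_ge0 i j : 0 <= wenergy i j.
Proof. by apply: integral_ge0 => y _; rewrite mule_ge0 ?wpot_ge0// lee_fin. Qed.

Lemma measurable_G2 x : measurable_fun setT (G x).
Proof. exact: (measurable_fun_pair2 x mG). Qed.

Lemma measurable_wpot j : measurable_fun setT (wpot j).
Proof.
apply: (@measurable_fun_fubini_tonelli_F _ _ T T R sigma
  (fun z : T * T => (h j z.2)%:E * G z.1 z.2)).
- apply: emeasurable_funM => //.
  exact: measurableT_comp (measurable_hE j) measurable_snd.
- by move=> z; rewrite mule_ge0// lee_fin.
Qed.

Lemma integral_h_cst i (k : \bar R) : 0 <= k -> \int[sigma]_x ((h i x)%:E * k) = k.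
Proof.
move=> k0; rewrite ge0_integralZr ?h1 ?mul1e//.
- exact: measurable_hE.
- by move=> x _; rewrite lee_fin.
Qed.

(** Pair energy when the first [m] points are chosen and the others are still
    random. *)
Definition mixed m (w : 'I_N -> T) (i j : 'I_N) : \bar R :=
  if (i < j)%N then
    if (j < m)%N then G (w i) (w j)
    else if (i < m)%N then wpot j (w i) else wenergy i j
  else 0.

Definition mixed_energy m w : \bar R := \sum_(p : 'I_N * 'I_N) mixed m w p.1 p.2.

Definition upd (w : 'I_N -> T) (m : 'I_N) (x : T) (i : 'I_N) : T :=
  if i == m then x else w i.

Lemma mixed_ge0 m w i j : 0 <= mixed m w i j.
Proof.
by rewrite /mixed; do 3 case: ifP => _ //; rewrite ?wpot_ge0 ?wenergy_ge0.
Qed.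

Lemma mixed_step w (m i j : 'I_N) :
  measurable_fun setT (fun x => mixed m.+1 (upd w m x) i j) /\
  \int[sigma]_x ((h m x)%:E * mixed m.+1 (upd w m x) i j) = mixed m w i j.
Proof.
have cst_case (k : \bar R) : 0 <= k ->
    (forall x, mixed m.+1 (upd w m x) i j = k) -> mixed m w i j = k ->
  measurable_fun setT (fun x => mixed m.+1 (upd w m x) i j) /\
  \int[sigma]_x ((h m x)%:E * mixed m.+1 (upd w m x) i j) = mixed m w i j.
  move=> k0 E1 E2; split.
    by under eq_fun do rewrite E1; exact: measurable_cst.
  by under eq_integral do rewrite E1; rewrite E2 integral_h_cst.
have [ij|ij] := boolP (i < j)%N; last first.
  by apply: (cst_case 0) => //; rewrite /mixed (negbTE ij).
have [jm|mj|jm] := ltngtP j m.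
- have im := ltn_trans ij jm.
  apply: (cst_case (G (w i) (w j))) => //; rewrite /mixed ij ?jm//.
  move=> x; rewrite (ltnW jm : (j < m.+1)%N).
  by rewrite /upd -!val_eqE /= !ltn_eqF.
- have [im|mi|im] := ltngtP i m.
  + apply: (cst_case (wpot j (w i))); first exact: wpot_ge0.
      move=> x; rewrite /mixed ij ltnS leqNgt mj /= ltnS (ltnW im).
      by rewrite /upd -val_eqE /= ltn_eqF.
    by rewrite /mixed ij ltnNge (ltnW mj) /= im.
  + apply: (cst_case (wenergy i j)); first exact: wenergy_ge0.
      by move=> x; rewrite /mixed ij (ltnS j) (ltnS i) (leqNgt j) (leqNgt i) mj mi.
    by rewrite /mixed ij (ltnNge j) (ltnNge i) (ltnW mj) (ltnW mi).
  + have {im} im : i = m by exact: val_inj.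
    have E x : mixed m.+1 (upd w m x) i j = wpot j x.
      by rewrite /mixed ij (ltnS j) (leqNgt j) mj /= im ltnS leqnn /upd eqxx.
    split; first by under eq_fun do rewrite E; exact: measurable_wpot.
    under eq_integral do rewrite E.
    by rewrite /mixed ij -im (ltnNge j) (ltnW ij) ltnn.
- have {jm} jm : j = m by exact: val_inj.
  have E x : mixed m.+1 (upd w m x) i j = G (w i) x.
    rewrite /mixed ij jm ltnS leqnn /upd eqxx -val_eqE /=.
    by rewrite ltn_eqF// -jm.
  split; first by under eq_fun do rewrite E; exact: measurable_G2.
  under eq_integral do rewrite E.
  by rewrite /mixed ij jm ltnn -{2}jm ij.
Qed.

Lemma mixed_energy_step w (m : 'I_N) :
  \int[sigma]_x ((h m x)%:E * mixed_energy m.+1 (upd w m x)) = mixed_energy m w.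
Proof.
under eq_integral => x _.
  rewrite /mixed_energy ge0_sume_distrr; last by move=> p _; exact: mixed_ge0.
  over.
rewrite ge0_integral_sum//.
- by apply: eq_bigr => p _; exact: (mixed_step w m p.1 p.2).2.
- move=> p; apply: emeasurable_funM; first exact: measurable_hE.
  exact: (mixed_step w m p.1 p.2).1.
- by move=> p x _; rewrite mule_ge0 ?mixed_ge0// lee_fin.
Qed.

Lemma measurable_mixed_energy w (m : 'I_N) :
  measurable_fun setT (fun x => mixed_energy m.+1 (upd w m x)).
Proof. by apply: emeasurable_sum => p; exact: (mixed_step w m p.1 p.2).1. Qed.

(** Averaging over the last chosen point turns [mixed_energy m.+1] into
    [mixed_energy m], so a lower bound valid for all configurations descends to
    the fully averaged energy. *)
Lemma averaging (e : \bar R) : 0 <= e ->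
  (forall w : 'I_N -> T, e <= \sum_(i < N) \sum_(j < N | (i < j)%N) G (w i) (w j)) ->
  e <= \sum_(i < N) \sum_(j < N | (i < j)%N) wenergy i j.
Proof.
move=> e0 he.
have H k : (k <= N)%N -> forall w, e <= mixed_energy (N - k) w.
  elim: k => [_ w|k IH kN w].
    rewrite subn0 /mixed_energy -(pair_bigA _ (fun i j : 'I_N => mixed N w i j)) /=.
    apply: (le_trans (he w)); apply: lee_sum => i _.
    rewrite big_mkcond /=; apply: lee_sum => j _.
    by rewrite /mixed ltn_ord; case: ifP.
  have mN : (N - k.+1 < N)%N by rewrite ltn_subrL; case: (N) kN.
  have E : (N - k)%N = (Ordinal mN).+1 by rewrite /= -subSn.
  rewrite -[leRHS](mixed_energy_step w (Ordinal mN)) -[leLHS](integral_h_cst (Ordinal mN) e0).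
  apply: ge0_le_integral => //.
  - by move=> x _; rewrite mule_ge0// lee_fin.
  - apply: emeasurable_funM; [exact: measurable_hE|exact: measurable_cst].
  - apply: emeasurable_funM; [exact: measurable_hE|exact: measurable_mixed_energy].
  - move=> x _; apply: lee_wpmul2l; first by rewrite lee_fin.
    by rewrite -E; apply: IH; exact: ltnW.
have := H N (leqnn N) (fun=> point); rewrite subnn.
rewrite /mixed_energy -(pair_bigA _ (fun i j : 'I_N => mixed 0 (fun=> point) i j)) /=.
move/le_trans; apply; apply: lee_sum => i _.
by rewrite [leRHS]big_mkcond /=; apply: lee_sum => j _; rewrite /mixed.
Qed.

End Averaging.

Section SymmetricKernel.
Context {d : measure_display} {T : measurableType d} {R : realType}.
Variable sigma : probability T R.
Variable G : T -> T -> \bar R.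
Local Open Scope ereal_scope.
Hypothesis G0 : forall x y, 0 <= G x y.
Hypothesis mG : measurable_fun setT (fun z : T * T => G z.1 z.2).
Hypothesis Gsym : forall x y, G x y = G y x.
Variable V : R.
Hypothesis potG : forall x, \int[sigma]_y G x y = V%:E.

Lemma sum_off_diag_sym (N : nat) (f : 'I_N -> 'I_N -> \bar R) :
  \sum_i \sum_(j | j != i) f i j = \sum_(i < N) \sum_(j < N | (i < j)%N) (f i j + f j i).
Proof.
under [RHS]eq_bigr do rewrite big_split.
rewrite big_split /= [X in _ + X](exchange_big_dep predT)//= -big_split /=.
apply: eq_bigr => i _; rewrite (bigID (fun j : 'I_N => (i < j)%N)) /=.
by congr (_ + _); apply: eq_bigl => j; rewrite -val_eqE /=; case: ltngtP.
Qed.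

Variables (N : nat) (h : 'I_N -> T -> R).
Hypothesis mh : forall i, measurable_fun [set: T] (h i).
Hypothesis h0 : forall i x, (0 <= h i x)%R.
Hypothesis h1 : forall i, \int[sigma]_x (h i x)%:E = 1.
Hypothesis hN : forall x, (\sum_i h i x = N%:R)%R.
Local Notation a := (wenergy sigma G h).

Lemma wenergy_sym i j : a i j = a j i.
Proof.
have mF (k l : 'I_N) : measurable_fun setT
    (fun z : T * T => (h k z.1)%:E * ((h l z.2)%:E * G z.1 z.2)).
  apply: emeasurable_funM.
    exact: measurableT_comp (measurable_hE mh k) measurable_fst.
  apply: emeasurable_funM => //.
  exact: measurableT_comp (measurable_hE mh l) measurable_snd.
have F0 (k l : 'I_N) (z : T * T) : 0 <= (h k z.1)%:E * ((h l z.2)%:E * G z.1 z.2).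
  by rewrite !mule_ge0// lee_fin.
have E (k l : 'I_N) : a k l =
    \int[sigma]_x \int[sigma]_y ((h k x)%:E * ((h l y)%:E * G x y)).
  apply: eq_integral => x _; rewrite ge0_integralZl//.
  - apply: emeasurable_funM; first exact: measurable_hE.
    exact: measurable_G2.
  - by move=> y _; rewrite mule_ge0// lee_fin.
  - by rewrite lee_fin.
rewrite !E (@fubini_tonelli _ _ T T R sigma sigma _ (mF i j) (F0 i j)) /=.
by apply: eq_integral => x _; apply: eq_integral => y _; rewrite muleCA Gsym.
Qed.

Lemma wenergy_total : \sum_i \sum_j a i j = (N%:R ^+ 2 * V)%:E.
Proof.
have pot x : \sum_j wpot sigma G h j x = (N%:R * V)%:E.
  rewrite /wpot -ge0_integral_sum//; last 2 first.
  - move=> j; apply: emeasurable_funM; first exact: measurable_hE.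
    exact: measurable_G2.
  - by move=> j y _; rewrite mule_ge0// lee_fin.
  under eq_integral => y _.
    rewrite -ge0_sume_distrl; last by move=> j _; rewrite lee_fin.
    rewrite sumEFin hN; over.
  rewrite ge0_integralZl ?potG//; exact: measurable_G2.
transitivity (\sum_(i < N) (N%:R * V)%:E); last first.
  by rewrite sumEFin sumr_const card_ord -[(_ *+ N)%R]mulr_natl mulrA.
have V0 : (0 <= V)%R by rewrite -lee_fin -(potG point); exact: integral_ge0.
apply: eq_bigr => i _.
rewrite /wenergy -ge0_integral_sum//; last 2 first.
- move=> j; apply: emeasurable_funM; first exact: measurable_hE.
  exact: measurable_wpot.
- by move=> j x _; rewrite mule_ge0 ?wpot_ge0// lee_fin.
under eq_integral => x _.
  rewrite -ge0_sume_distrr; last by move=> j _; exact: wpot_ge0.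
  rewrite pot; over.
by rewrite integral_h_cst// lee_fin mulr_ge0.
Qed.

(** Independent points of densities [h i] have as mean energy the sum of the
    mutual energies over i <> j.  With the diagonal included this sum is N^2 V,
    because the densities add up to N. *)
Lemma minimal_energy_le :
  minimal_energy G N + \sum_i a i i <= (N%:R ^+ 2 * V)%:E.
Proof.
(* [averaging] counts each pair once. *)
pose G2 x y := G x y + G x y.
have G20 x y : 0 <= G2 x y by rewrite adde_ge0.
have mG2 : measurable_fun setT (fun z : T * T => G2 z.1 z.2).
  exact: emeasurable_funD.
have e0 : 0 <= minimal_energy G N.
  apply: le_ereal_inf_tmp => _ [w _ <-]; apply: sume_ge0 => i _.
  by apply: sume_ge0 => j _.
have pot2 j x : wpot sigma G2 h j x = wpot sigma G h j x + wpot sigma G h j x.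
  rewrite /wpot -ge0_integralD//.
  - by apply: eq_integral => y _; rewrite ge0_muleDr.
  - by move=> y _; rewrite mule_ge0// lee_fin.
  - apply: emeasurable_funM; first exact: measurable_hE.
    exact: measurable_G2.
  - by move=> y _; rewrite mule_ge0// lee_fin.
  - apply: emeasurable_funM; first exact: measurable_hE.
    exact: measurable_G2.
have a2 i j : wenergy sigma G2 h i j = a i j + a i j.
  rewrite /wenergy -ge0_integralD//.
  - by apply: eq_integral => y _; rewrite pot2 ge0_muleDr// wpot_ge0.
  - by move=> y _; rewrite mule_ge0 ?wpot_ge0// lee_fin.
  - apply: emeasurable_funM; first exact: measurable_hE.
    exact: measurable_wpot.
  - by move=> y _; rewrite mule_ge0 ?wpot_ge0// lee_fin.
  - apply: emeasurable_funM; first exact: measurable_hE.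
    exact: measurable_wpot.
have le : minimal_energy G N <= \sum_(i < N) \sum_(j < N | (i < j)%N) wenergy sigma G2 h i j.
  apply: (averaging G20 mG2 mh h0 h1 e0) => w; apply: (@le_trans _ _ (energy G w)).
    by apply: ereal_inf_lbound; exists w.
  rewrite /energy sum_off_diag_sym; apply: lee_sum => i _; apply: lee_sum => j _.
  by rewrite (Gsym (w j)).
have {}le : minimal_energy G N <= \sum_i \sum_(j | j != i) a i j.
  apply: (le_trans le); rewrite sum_off_diag_sym.
  apply: lee_sum => i _; apply: lee_sum => j _.
  by rewrite a2 (wenergy_sym j i).
rewrite -wenergy_total.
apply: (le_trans (leeD2r _ le)); rewrite -big_split /=.
by apply: lee_sum => i _; rewrite [leRHS](bigD1 i)//= addeC.
Qed.

End SymmetricKernel.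

(** * The upper bound *)

Section Cells.
Context {d : measure_display} {T : measurableType d} {R : realType}.
Variable sigma : probability T R.
Variables (I : finType) (phi : I -> T -> R).
Hypothesis mphi : forall e, measurable_fun [set: T] (phi e).
Local Notation t := (inner phi).
Hypothesis t01 : forall x y, 0 <= t x y <= 1.
Hypothesis txx : forall x, t x x = 1.
Variable V : R.
Local Notation G := (fun x y : T => log_kernel (t x y)).
Hypothesis potG : forall x, (\int[sigma]_y G x y)%E = V%:E.

Lemma G_ge0 x y : (0 <= G x y)%E.
Proof. by apply: log_kernel_ge0; case/andP: (t01 x y). Qed.

Lemma G_sym x y : G x y = G y x.
Proof. by rewrite /= inner_sym. Qed.

Lemma card_coord_gt0 : (0 < #|I|)%N.
Proof.
rewrite lt0n; apply/eqP => I0; have := txx point; rewrite /inner big1 => [/eqP|e].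
  by rewrite eq_sym oner_eq0.
by have := card0_eq I0 e.
Qed.

(** Grid position of a point along a coordinate, for a grid of step 2/q. *)
Definition grid_pos (q : nat) e x : R := (phi e x + 1) * (q%:R / 2).

Definition cell q (c : {ffun I -> 'I_q.+1}) : set T :=
  [set x | forall e, (c e)%:R <= grid_pos q e x < (c e).+1%:R].

Lemma measurable_cell q c : measurable (@cell q c).
Proof.
have -> : @cell q c = \bigcap_(e in [set: I])
    (grid_pos q e @^-1` `[(c e)%:R, (c e).+1%:R[).
  apply/seteqP; split=> x /= h e; first by move=> _ /=; rewrite in_itv /=; exact: h.
  by have := h e Logic.I; rewrite /= in_itv.
apply: fin_bigcap_measurable => // e _.
rewrite -[X in measurable X]setTI.
have mg : measurable_fun setT (grid_pos q e).
  by apply: measurable_funM => //; apply: measurable_funD.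
by apply: mg => //; exact: measurable_itv.
Qed.

Lemma cell_inj q (c c' : {ffun I -> 'I_q.+1}) x : cell c x -> cell c' x -> c = c'.
Proof.
move=> hc hc'; apply/ffunP => e; apply/val_inj/eqP; rewrite eqn_leq.
have /andP[a b] := hc e; have /andP[a' b'] := hc' e.
have := le_lt_trans a b'; have := le_lt_trans a' b.
by rewrite !ltr_nat !ltnS => -> ->.
Qed.

Lemma cell_cover q x : exists c : {ffun I -> 'I_q.+1}, cell c x.
Proof.
exists [ffun e => inord (Num.truncn (grid_pos q e x))] => e; rewrite ffunE.
have /andP[a b] := coord_range txx e x.
have g0 : 0 <= grid_pos q e x by rewrite mulr_ge0// -(opprK 1) subr_ge0.
have gq : grid_pos q e x <= q%:R.
  have q0 : (0 : R) <= q%:R by [].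
  by rewrite /grid_pos; nra.
have /andP[l u] := truncn_itv g0.
rewrite inordK ?l ?u// ltnS -(ler_nat R).
exact: le_trans gq.
Qed.

Lemma cell_close q (c : {ffun I -> 'I_q.+1}) x y : (0 < q)%N ->
  cell c x -> cell c y -> 1 - t x y <= 2 * #|I|%:R / q%:R ^+ 2.
Proof.
move=> q0 hx hy; have q0' : (0 : R) < q%:R by rewrite ltr0n.
have : \sum_e (phi e x - phi e y) ^+ 2 <= \sum_(e : I) (2 / q%:R) ^+ 2.
  apply: ler_sum => e _.
  have /andP[a b] := hx e; have /andP[a' b'] := hy e.
  have E : grid_pos q e x - grid_pos q e y = (phi e x - phi e y) * (q%:R / 2).
    by rewrite /grid_pos; ring.
  rewrite -(@ler_pM2r _ ((q%:R / 2) ^+ 2)) ?exprn_gt0 ?divr_gt0//.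
  rewrite -!exprMn -E.
  have -> : 2 / q%:R * (q%:R / 2) = 1 :> R by field; rewrite gt_eqF.
  rewrite expr1n; move: a b a' b'; rewrite -natr1.
  move: (grid_pos _ _ _) (grid_pos _ _ _) (_%:R) => u v w; nra.
rewrite (dist_inner txx) sumr_const -[leRHS]mulr_natl expr_div_n.
have -> : #|I|%:R * (2 ^+ 2 / q%:R ^+ 2) = 2 * (2 * #|I|%:R / q%:R ^+ 2) :> R.
  by field; rewrite gt_eqF.
by rewrite ler_pM2l.
Qed.

Section Strata.
Variables (q N : nat).
Hypothesis q0 : (0 < q)%N.
Hypothesis N0 : (0 < N)%N.
Local Notation J := {ffun I -> 'I_q.+1}.

Definition cell_ind (c : J) (x : T) : R := \1_(cell c) x.
Definition cell_mass (c : J) : R := (\int[sigma]_x cell_ind c x)%R.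

(** Number of points sent to a cell: its share of [N - 1] points, rounded down.
    The factor is [N - 1] so that at least one point is left to carry the
    remaining mass. *)
Definition cell_count (c : J) : nat := Num.truncn (N.-1%:R * cell_mass c).
Definition rest_count : nat := (N - \sum_c cell_count c)%N.

Lemma bdd_cell_ind c : bdd_measurable (cell_ind c).
Proof.
split; first by apply: measurable_indic; exact: measurable_cell.
by exists 1 => x; rewrite /cell_ind indicE; case: (_ \in _); rewrite ?normr1 ?normr0.
Qed.

Lemma sum_cell_ind (f : J -> R) x c : cell c x -> \sum_c' f c' * cell_ind c' x = f c.
Proof.
move=> cx; rewrite (bigD1 c)//= big1 ?addr0.
  by rewrite /cell_ind indicE mem_set// mulr1.
move=> c' /eqP c'c; rewrite /cell_ind indicE memNset ?mulr0//.
by move=> c'x; apply: c'c; exact: cell_inj c'x cx.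
Qed.

Lemma cell_mass_ge0 c : 0 <= cell_mass c.
Proof. by apply: Rintegral_ge0 => x _; rewrite /cell_ind indicE. Qed.

Lemma sum_cell_mass : \sum_c cell_mass c = 1.
Proof.
rewrite -Rintegral_sum; last exact: bdd_cell_ind.
rewrite -[RHS](Rintegral_cst1 sigma 1); apply: eq_Rintegral => x _.
have [c cx] := cell_cover q x.
by rewrite -[RHS](@sum_cell_ind (fun=> 1) x c cx); apply: eq_bigr => c' _; rewrite mul1r.
Qed.

Lemma cell_count_le c : (cell_count c)%:R <= N.-1%:R * cell_mass c.
Proof. by rewrite truncn_le// mulr_ge0// cell_mass_ge0. Qed.

Lemma cell_count_mass c : (cell_count c)%:R * (cell_mass c / cell_mass c) = (cell_count c)%:R.
Proof.
have [m0|m0] := eqVneq (cell_mass c) 0; last by rewrite divff ?mulr1.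
by rewrite /cell_count m0 mulr0 truncn0 mul0r.
Qed.

Lemma sum_cell_count_lt : (\sum_c cell_count c < N)%N.
Proof.
rewrite -(prednK N0) ltnS -(ler_nat R) natr_sum.
apply: (@le_trans _ _ (\sum_c N.-1%:R * cell_mass c)).
  by apply: ler_sum => c _; exact: cell_count_le.
by rewrite -mulr_sumr sum_cell_mass mulr1.
Qed.

Lemma sum_cell_count_ge :
  N%:R - 1 - (q.+1 ^ #|I|)%N%:R <= \sum_c (cell_count c)%:R :> R.
Proof.
have -> : N%:R - 1 - (q.+1 ^ #|I|)%N%:R = \sum_(c : J) (N.-1%:R * cell_mass c - 1) :> R.
  rewrite sumrB -mulr_sumr sum_cell_mass mulr1 sumr_const card_ffun card_ord.
  by rewrite -[N in LHS](prednK N0) -natr1 addrK.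
by apply: ler_sum => c _; rewrite lerBlDr natr1 ltW// truncnS_gt.
Qed.

Lemma rest_gt0 : (0 < rest_count)%N.
Proof. by rewrite subn_gt0 sum_cell_count_lt. Qed.

(** Densities of the N laws: the uniform law on a cell, used [cell_count] times,
    and the normalized remainder of N sigma, used [rest_count] times. *)
Definition stratum (o : option J) (x : T) : R :=
  match o with
  | Some c => cell_ind c x / cell_mass c
  | None => (N%:R - \sum_c (cell_count c)%:R * (cell_ind c x / cell_mass c))
              / rest_count%:R
  end.

Definition strata : seq (option J) :=
  flatten [seq nseq (cell_count c) (Some c) | c <- enum J] ++ nseq rest_count None.

Lemma sum_strata (F : option J -> R) : \sum_(o <- strata) F o =
  \sum_c (cell_count c)%:R * F (Some c) + rest_count%:R * F None.
Proof.
rewrite big_cat big_flatten big_map /= big_enum /=; congr (_ + _).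
  by apply: eq_bigr => c _; rewrite big_nseq iter_addr_0 mulr_natl.
by rewrite big_nseq iter_addr_0 mulr_natl.
Qed.

Lemma size_strata : size strata = N.
Proof.
have := sum_strata (fun=> 1); rewrite big_const_seq count_predT iter_addr_0.
under eq_bigr do rewrite mulr1.
rewrite mulr1 -natr_sum -natrD /rest_count subnKC; last exact/ltnW/sum_cell_count_lt.
by move/eqP; rewrite eqr_nat => /eqP.
Qed.

Lemma strata_mass c : Some c \in strata -> 0 < cell_mass c.
Proof.
rewrite mem_cat mem_nseq andbF orbF => /flatten_mapP[c' _].
rewrite mem_nseq => /andP[k0 /eqP[->]].
rewrite lt_neqAle cell_mass_ge0 andbT eq_sym; apply: contraTneq k0 => m0.
by rewrite /cell_count m0 mulr0 truncn0.
Qed.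

Lemma bdd_cell_density c : bdd_measurable (fun x => cell_ind c x / cell_mass c).
Proof. by apply: bddM; [exact: bdd_cell_ind|exact: bdd_cst]. Qed.

Lemma bdd_rest : bdd_measurable
  (fun x => N%:R - \sum_c (cell_count c)%:R * (cell_ind c x / cell_mass c)).
Proof.
have -> : (fun x => N%:R - \sum_c (cell_count c)%:R * (cell_ind c x / cell_mass c)) =
    (fun x => \sum_(b : bool) if b then N%:R else
       (-1) * \sum_c (cell_count c)%:R * (cell_ind c x / cell_mass c)).
  by apply/funext => x; rewrite big_bool mulN1r.
apply: bdd_sum => -[]; first exact: bdd_cst.
apply: bddM; first exact: bdd_cst.
by apply: bdd_sum => c; apply: bddM; [exact: bdd_cst|exact: bdd_cell_density].
Qed.

Lemma bdd_stratum o : bdd_measurable (stratum o).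
Proof.
case: o => [c|]; first exact: bdd_cell_density.
by apply: bddM; [exact: bdd_rest|exact: bdd_cst].
Qed.

Lemma stratum_ge0 o x : 0 <= stratum o x.
Proof.
case: o => [c|] /=.
  by rewrite divr_ge0 ?cell_mass_ge0// /cell_ind indicE.
rewrite divr_ge0// subr_ge0.
under eq_bigr => c _ do rewrite mulrA mulrAC.
have [c cx] := cell_cover q x; rewrite (sum_cell_ind _ cx).
have [m0|m0] := eqVneq (cell_mass c) 0; first by rewrite m0 invr0 mulr0.
have m_gt0 : 0 < cell_mass c by rewrite lt_neqAle cell_mass_ge0 eq_sym m0.
rewrite ler_pdivrMr//; apply: le_trans (cell_count_le c) _.
by rewrite ler_pM2r// ler_nat leq_pred.
Qed.

Lemma stratum_integral o : o \in strata -> (\int[sigma]_x stratum o x = 1)%R.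
Proof.
have S c : (\int[sigma]_x (cell_ind c x / cell_mass c) = cell_mass c / cell_mass c)%R.
  by rewrite RintegralZr//; exact: bdd_integrable (bdd_cell_ind c).
case: o => [c /strata_mass m0|_].
  by rewrite /stratum S divff// gt_eqF.
have bS c : bdd_measurable (fun x => (cell_count c)%:R * (cell_ind c x / cell_mass c)).
  by apply: bddM; [exact: bdd_cst|exact: bdd_cell_density].
rewrite /stratum RintegralZr//; last first.
  exact: bdd_integrable bdd_rest.
rewrite RintegralB//; last 2 first.
- exact: bdd_integrable (bdd_cst _).
- exact: bdd_integrable (bdd_sum _ bS).
rewrite Rintegral_cst1 Rintegral_sum//.
under eq_bigr => c _.
  rewrite RintegralZl//; last first.
    exact: bdd_integrable (bdd_cell_density c).
  rewrite S cell_count_mass; over.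
rewrite -natr_sum -natrB ?divff//; last exact/ltnW/sum_cell_count_lt.
by rewrite pnatr_eq0 -lt0n rest_gt0.
Qed.

Lemma sum_stratum x : \sum_(o <- strata) stratum o x = N%:R.
Proof.
rewrite sum_strata /= mulrC divfK; last by rewrite pnatr_eq0 -lt0n rest_gt0.
by rewrite addrC subrK.
Qed.

Local Notation h := (fun i : 'I_N => stratum (nth None strata i)).

Lemma nth_strata (i : 'I_N) : nth None strata i \in strata.
Proof. by rewrite mem_nth// size_strata. Qed.

Lemma sum_nth_strata (F : option J -> R) :
  \sum_(i < N) F (nth None strata i) = \sum_(o <- strata) F o.
Proof. by rewrite (big_nth None) size_strata big_mkord. Qed.

Lemma h_integral i : (\int[sigma]_x (h i x)%:E = 1)%E.
Proof.
by rewrite EFin_Rintegral ?stratum_integral ?nth_strata//; exact: bdd_stratum.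
Qed.

(** The law attached to a cell only sees pairs of points of that cell. *)
Lemma wenergy_ge_cell (L : R) (i : 'I_N) c : 0 <= L -> nth None strata i = Some c ->
  (forall x y, cell c x -> cell c y -> (L%:E <= G x y)%E) ->
  (L%:E <= wenergy sigma G h i i)%E.
Proof.
move=> L0 ic hL.
have mh (j : 'I_N) : measurable_fun setT (h j) by exact: (bdd_stratum _).1.
have h0 (j : 'I_N) x : 0 <= h j x by exact: stratum_ge0.
have mG := measurable_log_kernel2 mphi t01.
have out x : ~ cell c x -> h i x = 0.
  by move=> cx; rewrite ic /= /cell_ind indicE memNset// mul0r.
have LE : (0 <= L%:E)%E by rewrite lee_fin.
rewrite -[leLHS](integral_h_cst mh h0 h_integral i LE).
apply: ge0_le_integral => //.
- by move=> x _; rewrite mule_ge0// lee_fin.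
- exact: (emeasurable_funM (measurable_hE mh i) (measurable_cst _)).
- apply: emeasurable_funM; first exact: (measurable_hE mh).
  exact: (measurable_wpot sigma G_ge0 mG mh h0).
- move=> x _; have [cx|cx] := pselect (cell c x); last by rewrite out// !mul0e.
  apply: lee_wpmul2l; first by rewrite lee_fin.
  rewrite -[leLHS](integral_h_cst mh h0 h_integral i LE).
  apply: ge0_le_integral => //.
  + by move=> y _; rewrite mule_ge0// lee_fin.
  + exact: (emeasurable_funM (measurable_hE mh i) (measurable_cst L%:E)).
  + have mGx : measurable_fun setT (fun y => G x y) := @measurable_G2 _ T R G mG x.
    exact: (emeasurable_funM (measurable_hE mh i) mGx).
  + move=> y _; have [cy|cy] := pselect (cell c y); last by rewrite out// !mul0e.
    by apply: lee_wpmul2l; [rewrite lee_fin|exact: hL].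
Qed.

(** Points of one cell satisfy rho^2 <= 2 p / q^2 with p coordinates, so the
    kernel is at least [L] there; at least N - 1 - (q+1)^p laws are attached to
    cells. *)
Lemma minimal_energy_grid (L := ln q%:R - ln (2 * #|I|%:R) / 2 : R) : 0 <= L ->
  (minimal_energy G N + ((N%:R - 1 - (q.+1 ^ #|I|)%N%:R) * L)%:E <= (N%:R ^+ 2 * V)%:E)%E.
Proof.
move=> L0.
have mh (j : 'I_N) : measurable_fun setT (h j) by exact: (bdd_stratum _).1.
have h0 (j : 'I_N) x : 0 <= h j x by exact: stratum_ge0.
have mG := measurable_log_kernel2 mphi t01.
have hN x : \sum_i h i x = N%:R.
  by rewrite (sum_nth_strata (fun o => stratum o x)) sum_stratum.
have q0' : (0 : R) < q%:R by rewrite ltr0n.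
have p0 : (0 : R) < 2 * #|I|%:R by rewrite mulr_gt0// ltr0n card_coord_gt0.
apply: (le_trans _ (minimal_energy_le G_ge0 mG G_sym potG mh h0 h_integral hN)).
apply: leeD2l.
pose Lo (o : option J) : R := if o is Some _ then L else 0.
apply: (@le_trans _ _ (\sum_(i < N) Lo (nth None strata i))%:E).
  rewrite lee_fin sum_nth_strata sum_strata /= mulr0 addr0 -mulr_suml.
  by apply: ler_wpM2r => //; exact: sum_cell_count_ge.
rewrite -sumEFin; apply: lee_sum => i _.
case E : (nth None strata i) => [c|] /=; last exact: (wenergy_ge0 _ G_ge0 h0).
apply: (wenergy_ge_cell L0 E) => x y cx cy.
apply: le_trans (log_kernel_ge _ (cell_close q0 cx cy)); last first.
  by rewrite divr_gt0// exprn_gt0.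
rewrite lee_fin /L ln_div ?posrE ?exprn_gt0// lnXn// -[ln q%:R *+ 2]mulr_natl.
by rewrite le_eqVlt; apply/orP; left; apply/eqP; field.
Qed.

End Strata.

(** The laws are all equal to sigma here. *)
Lemma minimal_energy_uniform N :
  (minimal_energy G N + (N%:R * V)%:E <= (N%:R ^+ 2 * V)%:E)%E.
Proof.
have mG := measurable_log_kernel2 mphi t01.
pose h (i : 'I_N) (x : T) : R := 1.
have h1 i : (\int[sigma]_x (h i x)%:E = 1)%E.
  by rewrite EFin_Rintegral ?Rintegral_cst1//; exact: bdd_cst.
have hN x : \sum_i h i x = N%:R by rewrite sumr_const card_ord.
have mh (i : 'I_N) : measurable_fun setT (h i) by exact: measurable_cst.
have h0 (i : 'I_N) x : 0 <= h i x by [].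
apply: (le_trans _ (minimal_energy_le G_ge0 mG G_sym potG mh h0 h1 hN)).
apply: leeD2l; rewrite le_eqVlt; apply/orP; left; apply/eqP.
transitivity (\sum_(i < N) V%:E)%E.
  by rewrite sumEFin sumr_const card_ord mulr_natl.
have V0 : (0 <= V%:E)%E by rewrite -(potG point); apply: integral_ge0 => y _; exact: G_ge0.
apply: eq_bigr => i _; rewrite -[LHS](integral_h_cst mh h0 h1 i V0).
apply: eq_integral => x _; congr (_ * _)%E; rewrite -(potG x).
by apply: eq_integral => y _; rewrite mul1e.
Qed.

End Cells.

(** * Choice of the constants *)

Section Asymptotics.
Variable R : realType.

Lemma ln2_gt0 : 0 < ln (2 : R).
Proof. by rewrite ln_gt0// ltr1n. Qed.

Lemma lower_constant : exists2 C : R, 0 < C & forall N : nat, (2 <= N)%N ->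
  N%:R * (36 + 3 * ln N%:R) <= C * N%:R * ln N%:R.
Proof.
have l2 := ln2_gt0; exists (3 + 36 / ln 2); first by rewrite addr_gt0// divr_gt0.
move=> N N2; rewrite -mulrA mulrCA ler_pM2l ?ltr0n ?(leq_trans _ N2)//.
rewrite [leRHS]mulrDl [leRHS]addrC lerD2r mulrAC ler_pdivlMr// ler_pM2l//.
by rewrite ler_ln ?posrE ?ltr0n ?(leq_trans _ N2)// ler_nat.
Qed.

Lemma grid_size (p N : nat) : (0 < p)%N -> (4 * 2 ^ p <= N)%N ->
  exists q, [/\ (0 < q)%N, (4 * q.+1 ^ p <= N)%N & (N < 4 * q.+2 ^ p)%N].
Proof.
move=> p0 hN; pose P q := (4 * q.+1 ^ p <= N)%N.
have exP : exists q, P q by exists 1%N.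
have ub q : P q -> (q <= N)%N.
  rewrite /P => h; apply: leq_trans h.
  apply: (leq_trans (leqnSn q)); apply: (@leq_trans (q.+1 ^ p)%N).
    by rewrite -{1}[q.+1]expn1 leq_pexp2l.
  by rewrite leq_pmull.
have [q Pq maxq] := ex_maxnP exP ub.
exists q; split=> //; first exact: (maxq 1%N hN).
by rewrite ltnNge; apply/negP => h; have := maxq q.+1 h; rewrite ltnn.
Qed.

(** When log N >= B, take the largest q with 4 (q+1)^p <= N: then
    log q - b >= log N / (2 p) and N - 1 - (q+1)^p >= N/4.  Below B the first
    hypothesis alone gives the constant V / B. *)
Lemma upper_constant (V b : R) (p : nat) : 0 < V -> 0 <= b -> (0 < p)%N ->
  exists2 C : R, 0 < C & forall (N : nat) (e : R), (2 <= N)%N ->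
    e + N%:R * V <= N%:R ^+ 2 * V ->
    (forall q, (0 < q)%N -> 0 <= ln q%:R - b ->
      e + (N%:R - 1 - (q.+1 ^ p)%N%:R) * (ln q%:R - b) <= N%:R ^+ 2 * V) ->
    e - V * N%:R ^+ 2 <= - C * N%:R * ln N%:R.
Proof.
move=> V0 b0 p0; have p0' : (0 : R) < p%:R by rewrite ltr0n.
have l2 := ln2_gt0.
have l3 : ln (2 : R) <= ln 3 by rewrite ler_ln ?posrE// ler_nat.
have l4 : ln (4 : R) = 2 * ln 2.
  by rewrite (_ : 4 = 2 ^+ 2); [rewrite lnXn// mulr_natl|rewrite -natrX].
pose B := 2 * ln 4 + 2 * p%:R * (ln 3 + b).
have pl3 : 0 < p%:R * (ln 3 + b) by rewrite mulr_gt0//; lra.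
have B0 : 0 < B by rewrite /B; lra.
exists (Num.min (V / B) (8 * p%:R)^-1).
  by rewrite lt_min divr_gt0//= invr_gt0 mulr_gt0.
move=> N e N2 hV hq.
have N0 : (0 : R) < N%:R by rewrite ltr0n (leq_trans _ N2).
have lN : 0 <= ln (N%:R : R) by rewrite ln_ge0// ler1n (leq_trans _ N2).
set C := Num.min _ _.
have C0 : 0 <= C.
  by rewrite /C le_min !divr_ge0 ?invr_ge0 ?(ltW V0) ?(ltW B0)// mulr_ge0.
have [NB|NB] := leP (ln N%:R) B.
  have CV : C <= V / B by rewrite ge_min lexx.
  have : C * ln N%:R <= V.
    apply: (@le_trans _ _ (V / B * B)); last by rewrite divfK ?gt_eqF.
    exact: ler_pM.
  rewrite -(ler_pM2r N0) => h; move: hV h; lra.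
have CV : C <= (8 * p%:R)^-1 by rewrite ge_min lexx orbT.
have hN : (4 * 2 ^ p <= N)%N.
  rewrite -(ler_nat R) -ler_ln ?posrE ?ltr0n ?muln_gt0 ?expn_gt0 ?(leq_trans _ N2)//.
  rewrite natrM natrX lnM ?posrE ?exprn_gt0// lnXn// -[ln 2 *+ p]mulr_natl.
  have : p%:R * ln (2 : R) <= p%:R * (ln 3 + b) by rewrite ler_pM2l//; lra.
  by move: NB; rewrite /B; lra.
have [q [q0 qN Nq]] := grid_size p0 hN.
have q0' : (0 : R) < q%:R by rewrite ltr0n.
have lq : ln (N%:R : R) <= ln 4 + p%:R * (ln q%:R + ln 3).
  apply: (@le_trans _ _ (ln (4 * (q%:R * 3) ^+ p))).
    rewrite ler_ln ?posrE ?mulr_gt0 ?exprn_gt0 ?mulr_gt0//.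
    apply: (@le_trans _ _ (4 * q.+2 ^ p)%N%:R); first by rewrite ler_nat ltnW.
    rewrite natrM natrX ler_pM2l// lerXn2r ?nnegrE ?mulr_ge0// -natrM ler_nat.
    by rewrite mulnS -addn2 leq_add2l (leq_trans _ (leq_pmull 2 q0)).
  rewrite lnM ?posrE ?exprn_gt0 ?mulr_gt0// lnXn ?mulr_gt0// lnM ?posrE//.
  by rewrite -[_ *+ p]mulr_natl.
have Lq : ln N%:R / (2 * p%:R) <= ln (q%:R : R) - b.
  rewrite ler_pdivrMr ?mulr_gt0//; move: NB; rewrite /B; lra.
have L0 : 0 <= ln (q%:R : R) - b.
  by apply: le_trans Lq; rewrite divr_ge0// mulr_ge0// ltW.
have hM : N%:R / 4 <= N%:R - 1 - (q.+1 ^ p)%N%:R :> R.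
  have := qN; rewrite -(ler_nat R) natrM.
  have : (2 : R) <= N%:R by rewrite ler_nat.
  by move: (N%:R) ((q.+1 ^ p)%N%:R) => u v; lra.
have := hq q q0 L0.
have : N%:R / 4 * (ln N%:R / (2 * p%:R)) <=
    (N%:R - 1 - (q.+1 ^ p)%N%:R) * (ln (q%:R : R) - b).
  apply: ler_pM => //; apply: divr_ge0 => //; exact: mulr_ge0.
have -> : N%:R / 4 * (ln N%:R / (2 * p%:R)) = (8 * p%:R)^-1 * (N%:R * ln (N%:R : R)).
  by field; rewrite gt_eqF.
have : C * (N%:R * ln N%:R) <= (8 * p%:R)^-1 * (N%:R * ln N%:R).
  by apply: ler_wpM2r => //; exact: mulr_ge0.
set z := (_ - _) * (ln _ - b); set y := (8 * _)^-1 * _; lra.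
Qed.

End Asymptotics.

(** * The logarithmic kernel on the projective space *)

Section Kernel.
Variables (R : realType) (F : scalars) (n : nat).
Hypothesis hO : F = Octonions -> n = 2%N.
Local Notation T := (borel_projspace R F n).

Lemma K0E : K0 R F n =
  (fun x y : T => log_kernel (inner (@proj_coord R F n : _ -> T -> R) x y)).
Proof.
apply/funext => x; apply/funext => y.
rewrite -[inner _ x y]overlap_coord.
have t1 := overlap_le1 x y; rewrite /K0 /chordal -/(overlap x y) /log_kernel.
case: ifPn => [lt1|]; last first.
  rewrite -leNgt => ge1; have -> : overlap x y = 1 by apply/eqP; rewrite eq_le t1.
  by rewrite subrr sqrtr0 /= lexx.
have s0 : 0 < Num.sqrt (1 - overlap x y) by rewrite sqrtr_gt0 subr_gt0.
rewrite lne_EFin// -EFinN; congr (_%:E).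
rewrite -{2}[1 - overlap x y]sqr_sqrtr ?subr_ge0// lnXn// -[_ *+ 2]mulr_natl.
by field.
Qed.

Lemma coordinate_frame : exists m, exists b : 'I_m -> T,
  forall y, \sum_i overlap (b i) y = 1.
Proof.
pose v (i j : 'I_n.+1) : R := (j == i)%:R.
have v1 i : \sum_j v i j ^+ 2 = 1.
  rewrite (bigD1 i)//= big1 ?addr0 ?/v ?eqxx ?expr1n// => j /negbTE.
  by rewrite /v => ->; rewrite expr0n.
have /boolp.choice [b bE] := fun i => real_point F (v1 i).
exists n.+1, b => y; have [_ _ trY] := set_valP y.
rewrite -(trace_re trY); apply: eq_bigr => i _.
rewrite /overlap hdotE (bE i) (bigD1 i)//= [X in _ + X]big1 ?addr0; last first.
  move=> j /negbTE ji; apply: big1 => k _.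
  by rewrite mxE /v ji mul0r scale0r /cd_dot (cd_mul0 _ _).1 cd_re0.
rewrite (bigD1 i)//= big1 ?addr0; last first.
  by move=> j /negbTE ji; rewrite mxE /v ji mulr0 scale0r /cd_dot (cd_mul0 _ _).1 cd_re0.
by rewrite mxE /v eqxx mulr1 scale1r cd_dotC cd_dot1.
Qed.

End Kernel.

Theorem theorem1p3 (R : realType) (F : scalars) (d : nat)
    (hd : (3 <= d)%N) (hO : F = Octonions -> d = 3%N)
    (sigma : probability (borel_projspace R F d.-1) R)
    (hsigma : isometry_invariant sigma) :
  exists C C' : R, [/\ 0 < C, 0 < C' & forall N : nat, (2 <= N)%N ->
    let D := (minimal_energy (K0 R F d.-1) N
              - energy_integral sigma (K0 R F d.-1) * (N%:R ^+ 2)%:E)%E in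
    ((- C * N%:R * ln N%:R)%:E <= D)%E /\
    (D <= (- C' * N%:R * ln N%:R)%:E)%E].
Proof.
move: hd hO sigma hsigma; case: d => // n n2 hO' sigma hsigma /=.
have {hO'} hO : F = Octonions -> n = 2%N by move=> /hO' [].
pose phi := @proj_coord R F n : _ -> borel_projspace R F n -> R.
have phiE x y : inner phi x y = overlap x y by rewrite overlap_coord.
have mphi e : measurable_fun setT (phi e) by exact: measurable_proj_coord.
have t01 x y : 0 <= inner phi x y <= 1.
  by rewrite phiE overlap_ge0 ?overlap_le1.
have txx x : inner phi x x = 1 by rewrite phiE overlapxx.
pose c k := (\int[sigma]_y (inner phi point y ^+ k))%R.
have hc k x : (\int[sigma]_y (inner phi x y ^+ k) = c k)%R.
  have := @potential_const R F n sigma hsigma hO (fun r => (`|r| ^+ k)%:E).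
  have E x' : (\int[sigma]_y (inner phi x' y ^+ k) =
      fine (\int[sigma]_y ((`|overlap x' y| ^+ k)%:E)))%R.
    congr fine; apply: eq_integral => y _; rewrite phiE ger0_norm//.
    exact: overlap_ge0.
  rewrite /c !E => H; congr fine; apply: H => [z|r]; last by rewrite lee_fin exprn_ge0.
  have -> : (fun y => (`|overlap z y| ^+ k)%:E) = (fun y => (inner phi z y ^+ k)%:E).
    by apply/funext => y; rewrite phiE ger0_norm// overlap_ge0.
  by apply/measurable_EFinP; exact: (bdd_innerX mphi txx z k).1.
have sep m : exists p : 'I_m -> borel_projspace R F n,
    forall i j, i != j -> inner phi (p i) (p j) <= 1 - (4 * m%:R ^+ 2)^-1.
  have [p hp] := @separated_points R F n m (ltnW n2).
  by exists p => i j ij; rewrite phiE; exact: hp.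
have frame : exists m, exists b : 'I_m -> borel_projspace R F n,
    forall y, \sum_i inner phi (b i) y = 1.
  have [m [b hb]] := coordinate_frame R F n; exists m, b => y.
  by under eq_bigr do rewrite phiE; exact: hb.
have [V potV hV] := log_potential mphi t01 txx hc sep.
have V0 : 0 < V.
  have /andP[V1 _] := hV 1%N isT; apply: lt_le_trans V1.
  rewrite exp1n /moment_sum big_ord_recl big_ord0 addr0 /= !divr_gt0//.
  exact: (moment1_gt0 mphi txx hc frame).
have I0 := card_coord_gt0 txx.
have b0 : 0 <= ln (2 * #|proj_idx F n|%:R : R) / 2.
  by rewrite divr_ge0// ln_ge0// -natrM ler1n muln_gt0.
have [C C0 hC] := lower_constant R.
have [C' C'0 hC'] := upper_constant V0 b0 I0.
exists C, C'; split=> // N N2 /=.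
have N0 : (0 < N)%N by exact: ltnW.
have EI : energy_integral sigma (K0 R F n) = V%:E.
  rewrite K0E -[RHS]mule1 -(probability_setT sigma) -integral_cst//.
  by apply: eq_integral => x _; exact: potV.
rewrite EI K0E -EFinM.
have lo : ((V * N%:R ^+ 2 - N%:R * (36 + 3 * ln N%:R))%:E <=
   minimal_energy (fun x y => log_kernel (inner phi x y)) N)%E.
  apply: le_ereal_inf_tmp => _ [w _ <-].
  exact: (energy_ge mphi t01 txx hc w N0 hV).
have up1 := minimal_energy_uniform mphi t01 potV N.
have up2 q (q0 : (0 < q)%N) := minimal_energy_grid mphi t01 txx potV q0 N0.
move: lo up1 up2; case: (minimal_energy _ N) => [e| |] //= lo up1 up2.
rewrite -EFinB !lee_fin; rewrite lee_fin in lo.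
split; first by have := hC N N2; move: lo; lra.
by apply: hC'.
Qed.
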